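(* There exist a compact plane set $X$ and a sequence of compact plane sets $X_k$ ($k\in\mathbb{N}$) such that $X=\bigcup_{k\in\mathbb{N}} X_k$ and $R(X_k)$ is regular for each $k\in\mathbb{N}$, but $R(X)$ is not regular.
   Context: A compact plane set is a non-empty compact subset of $\mathbb{C}$. For a compact plane set $X$, $C(X)$ is the algebra of continuous complex-valued functions on $X$ with the uniform norm, and $R(X)$ is the set of those $f\in C(X)$ which can be uniformly approximated on $X$ by rational functions with no poles on $X$. $R(X)$ is a uniform algebra on $X$ (a closed subalgebra of $C(X)$ that contains the constants and separates the points of $X$), and it is natural: its character space is $X$, with points identified with evaluation functionals. $R(X)$ is called regular if, for every closed subset $F$ of $X$ and every $y\in X\setminus F$, there exists $f\in R(X)$ with $f(y)=1$ and $f(F)\subseteq\{0\}$. *)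

(* Defs.v *)
From HB Require Import structures.
From mathcomp Require Import all_boot all_order all_algebra.
From mathcomp Require Import complex.
From mathcomp Require Import all_classical all_reals all_analysis.

Set Implicit Arguments.
Unset Strict Implicit.
Unset Printing Implicit Defensive.

Import Order.TTheory GRing.Theory Num.Theory.
Import numFieldNormedType.Exports.

Local Open Scope classical_set_scope.
Local Open Scope ring_scope.
Local Open Scope complex_scope.

(* [R[i]] itself carries no topology. Packing it as a [numClosedFieldType] gives
   it the topology, uniformity and norm that every [numFieldType] has, i.e.
   those of the modulus [`|z|]. *)
Definition cplx (R : realType) : numClosedFieldType := R[i].

Definition compact_plane_set (R : realType) (X : set (cplx R)) : Prop :=
  compact X /\ X !=set0.

(* Functions on [X] are represented by total functions on the plane, of which
   only the values on [X] are relevant: all the sets of functions below are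
   invariant under changing a function outside [X]. *)
Definition continuous_functions (R : realType) (X : set (cplx R)) :
    set (cplx R -> cplx R) :=
  [set f | {within X, continuous f}].

Definition rational_functions (R : realType) (X : set (cplx R)) :
    set (cplx R -> cplx R) :=
  [set r | exists p q : {poly cplx R},
    forall z, X z -> q.[z] != 0 /\ r z = p.[z] / q.[z]].

(* The algebra R(X). *)
Definition rational_algebra (R : realType) (X : set (cplx R)) :
    set (cplx R -> cplx R) :=
  [set f | continuous_functions X f /\
    forall e : R, 0 < e -> exists2 r, rational_functions X r &
      forall z, X z -> `|f z - r z| < e%:C].

(* As [X] is compact, hence closed, the closed subsets of [X] are the closed
   subsets of the plane that are included in [X]. *)
Definition regular_on (R : realType) (X : set (cplx R))
    (A : set (cplx R -> cplx R)) : Prop :=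
  forall (F : set (cplx R)) (y : cplx R),
    closed F -> F `<=` X -> (X `\` F) y ->
    exists2 f, A f & f y = 1 /\ f @` F `<=` [set 0].

(* Main.v *)
(* Let I = [0, 1] and let X be a closed disc minus countably many small open discs (the holes) staying
   away from I. The holes are provided by McKissick's lemma: for each disc D of a countable base of
   the complement of I, there are holes of arbitrarily small total radius near D, and rational
   functions with poles in these holes which converge uniformly off the holes to a function that
   vanishes exactly outside D. Hence R(Y) is regular for each compact subset Y of X missing I; it is
   also regular for Y = I, and X is a countable union of such sets Y.

   If the holes are small enough with respect to their distance to I, the functions of R(X) are
   quasianalytic on I: f = 0 on [0, 1/2] implies f(1) = 0. Pushing the pole 1 along I, as in Runge's
   theorem, gives K_j(w) = 1/(w - 1) - (a combination of the 1/(w - x) with x in [0, 1/2]) such that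
   |K_j| <= 1/(j + 1) except near I; the radii of the holes of index i are then chosen small with
   respect to K_0, ..., K_i. Integrating f K_j over the boundary of X gives
   |f(1)| <= (constant) * sup |f| / (j + 1) for all j. For rational f, only finitely many holes
   matter; overlapping holes are merged into disjoint discs, and Cauchy's theorem is proved with
   means over roots of unity in place of integrals. *)
Require Import Defs.
From HB Require Import structures.
From mathcomp Require Import all_boot all_order all_algebra.
From mathcomp Require Import complex.
From mathcomp Require Import all_classical all_reals all_analysis.
From mathcomp Require Import ring lra zify.

Set Implicit Arguments.
Unset Strict Implicit.
Unset Printing Implicit Defensive.

Import Order.TTheory GRing.Theory Num.Theory.
Import numFieldNormedType.Exports.

Local Open Scope classical_set_scope.
Local Open Scope ring_scope.
Local Open Scope complex_scope.

(** * The modulus and the topology of the plane *)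

(** The order of the choices avoids a circle. The discs D_i come first; K_j depends only on them,
    through the distance [min_rho j] from I beyond which it must be small; the total radius of the
    holes of D_i comes last, since McKissick's lemma allows any positive value. On a hole of index i
    < j, |K_j| <= 1/(j + 1). For i >= j only the bound (sum of |coefficients|) / (distance to I) is
    left, and the radii absorb it up to 2^-i; the sum over i >= j is at most 2 * 2^-j <= 2/(j + 1).

    K_j has simple poles only: integrating against it yields values of f, which uniform
    approximation controls, and no derivatives.

    X has infinitely many holes and no usable boundary. A rational function without poles on X is,
    by compactness, bounded on the disc off finitely many holes, and these alone are removed. They
    may overlap or cut the outer circle: merging keeps the sum of the radii, and the outer radius is
    moved into a gap. A merged disc mixes several indices, so the bounds are made monotone in the
    index and the least index decides. *)

Section Modulus.
Variable R : realType.
Implicit Types (z w : cplx R) (x : R).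

Definition modulus z : R := ComplexField.Normc.normc z.

Lemma normE z : `|z| = (modulus z)%:C.
Proof. by []. Qed.

Lemma modulus_ge0 z : 0 <= modulus z.
Proof. by case: z => a b; exact: sqrtr_ge0. Qed.

Lemma modulusM z w : modulus (z * w) = modulus z * modulus w.
Proof. exact: ComplexField.Normc.normcM. Qed.

Lemma modulusD z w : modulus (z + w) <= modulus z + modulus w.
Proof. by have := ler_normD z w; rewrite !normE -rmorphD /= lecR. Qed.

Lemma modulus0 : modulus 0 = 0.
Proof. exact: ComplexField.Normc.normc0. Qed.

Lemma modulus1 : modulus 1 = 1.
Proof. exact: ComplexField.Normc.normc1. Qed.

Lemma modulusN z : modulus (- z) = modulus z.
Proof. by apply: (@complexI R); rewrite -!normE normrN. Qed.

Lemma modulusB z w : modulus (z - w) = modulus (w - z).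
Proof. by rewrite -modulusN opprB. Qed.

Lemma modulusV z : modulus z^-1 = (modulus z)^-1.
Proof. exact: ComplexField.Normc.normcV. Qed.

Lemma modulusX z n : modulus (z ^+ n) = modulus z ^+ n.
Proof. by elim: n => [|n IH]; rewrite ?expr0 ?modulus1 // !exprS modulusM IH. Qed.

Lemma modulus_eq0 z : (modulus z == 0) = (z == 0).
Proof. by rewrite -[RHS]normr_eq0 normE (inj_eq (@complexI _)). Qed.

Lemma modulus_gt0 z : (0 < modulus z) = (z != 0).
Proof. by rewrite lt_def modulus_ge0 andbT modulus_eq0. Qed.

Lemma modulus_real x : modulus x%:C = `|x|.
Proof. by rewrite /modulus /= expr0n addr0 sqrtr_sqr. Qed.

Lemma modulusBD z w u : modulus (z - w) <= modulus (z - u) + modulus (u - w).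
Proof. by have := modulusD (z - u) (u - w); rewrite addrA subrK. Qed.

Lemma modulusBr z w : modulus z - modulus w <= modulus (z - w).
Proof. by rewrite lerBlDr; have := modulusD (z - w) w; rewrite subrK. Qed.

Lemma modulus_sum (I : Type) (r : seq I) (P : pred I) (F : I -> cplx R) :
  modulus (\sum_(i <- r | P i) F i) <= \sum_(i <- r | P i) modulus (F i).
Proof.
elim/big_rec2: _ => [|i x y _ H]; first by rewrite modulus0.
by apply: le_trans (modulusD _ _) _; rewrite lerD2l.
Qed.

Lemma modulus_prod (I : Type) (r : seq I) (P : pred I) (F : I -> cplx R) :
  modulus (\prod_(i <- r | P i) F i) = \prod_(i <- r | P i) modulus (F i).
Proof. exact: (big_morph modulus modulusM modulus1). Qed.

Lemma natC n : (n%:R : cplx R) = (n%:R : R)%:C.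
Proof. by rewrite rmorph_nat. Qed.

Lemma modulus_nat n : modulus n%:R = n%:R.
Proof. by rewrite natC modulus_real ger0_norm. Qed.

Lemma Re_le_modulus z : `|complex.Re z| <= modulus z.
Proof.
case: z => a b /=; rewrite -sqrtr_sqr; apply: ler_wsqrtr.
by rewrite lerDl sqr_ge0.
Qed.

Lemma Im_le_modulus z : `|complex.Im z| <= modulus z.
Proof.
case: z => a b /=; rewrite -sqrtr_sqr; apply: ler_wsqrtr.
by rewrite lerDr sqr_ge0.
Qed.

Lemma modulus_le z : modulus z <= `|complex.Re z| + `|complex.Im z|.
Proof.
case: z => a b; rewrite /modulus /=.
rewrite -[leRHS]ger0_norm ?addr_ge0 // -sqrtr_sqr; apply: ler_wsqrtr.
rewrite sqrrD !real_normK ?num_real // -addrA [`|a| * _ *+ 2 + _]addrC addrA.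
by rewrite lerDl mulrn_wge0 // mulr_ge0.
Qed.

End Modulus.

Section Topology.
Variable R : realType.
Implicit Types (z w : cplx R) (X : set (cplx R)).

Lemma nbhs_modulusP z (A : set (cplx R)) :
  nbhs z A <-> exists2 e : R, 0 < e & forall w, modulus (w - z) < e -> A w.
Proof.
split.
  move=> /nbhs_ballP [e e0 H].
  have e0' : (0 : cplx R) < e by [].
  (* In the order of [R[i]] only numbers with equal imaginary parts are comparable, so [0 < e] makes
     [e] real. *)
  have [r Er] : exists r : R, e = r%:C.
    by exists (complex.Re e); case: e e0' {e0 H} => a b; rewrite ltcE /= => /andP[/eqP -> _].
  exists r; first by move: e0'; rewrite Er ltcR.
  move=> w Hw; apply: H; rewrite -ball_normE /= distrC normE Er ltcR //.
move=> [e e0 H]; apply/nbhs_ballP; exists e%:C; first by rewrite /= ltcR.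
by move=> w; rewrite -ball_normE /= distrC normE ltcR => /H.
Qed.

Lemma open_modulusP (A : set (cplx R)) :
  open A <-> forall z, A z -> exists2 e : R, 0 < e & forall w, modulus (w - z) < e -> A w.
Proof.
rewrite openE; split => H z /H; first by rewrite /interior => /nbhs_modulusP.
by move=> Hz; apply/nbhs_modulusP.
Qed.

Lemma open_disc c (r : R) : open [set z | modulus (z - c) < r].
Proof.
apply/open_modulusP => z /= Hz; exists (r - modulus (z - c)); first by rewrite subr_gt0.
by move=> w Hw /=; have := modulusBD w c z; lra.
Qed.

Lemma open_outer c (r : R) : open [set z | r < modulus (z - c)].
Proof.
apply/open_modulusP => z /= Hz; exists (modulus (z - c) - r); first by rewrite subr_gt0.
by move=> w; rewrite /= modulusB => Hw; have := modulusBD z c w; lra.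
Qed.

Lemma within_modulusP X (f : cplx R -> cplx R) :
  {within X, continuous f} <->
  forall z, X z -> forall e : R, 0 < e -> exists2 d : R, 0 < d &
    forall w, X w -> modulus (w - z) < d -> modulus (f w - f z) < e.
Proof.
rewrite continuous_subspace_in; split => H z.
  move=> Xz e e0.
  have /H : z \in X by rewrite inE.
  move=> /(_ [set u | modulus (u - f z) < e]).
  rewrite /= /nbhs /= => K.
  have /K : nbhs (f z) [set u | modulus (u - f z) < e].
    by apply/nbhs_modulusP; exists e.
  rewrite /nbhs_subspace /= ; case: ifPn => [_|]; last by rewrite notin_setE.
  rewrite /within /= => /nbhs_modulusP [d d0 Hd].
  by exists d => // w Xw /Hd; exact.
rewrite inE => Xz A /nbhs_modulusP [e e0 HA].
have [d d0 Hd] := H z Xz e e0.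
rewrite /= /nbhs /= /nbhs_subspace; case: ifPn => [_|]; last by rewrite notin_setE.
rewrite /within /=; apply/nbhs_modulusP; exists d => // w Hw Xw.
by apply: HA; exact: Hd.
Qed.

Lemma compact_disc (r : R) : compact [set z : cplx R | modulus z <= r].
Proof.
pose phi (p : R^o * R^o) : cplx R := p.1 +i* p.2.
have cphi : continuous phi.
  move=> [a b] A /nbhs_modulusP [e e0 HA].
  have e20 : 0 < e / 2 by rewrite divr_gt0.
  exists (ball (a : R^o) (e/2), ball (b : R^o) (e/2)); first by split; apply: nbhsx_ballx.
  move=> [u v] /= [Hu Hv]; apply: HA.
  apply: le_lt_trans (modulus_le _) _ => /=.
  move: Hu Hv; rewrite -!ball_normE /= => Hu Hv.
  by rewrite [`|u - a|]distrC [`|v - b|]distrC; lra.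
have cI := @segment_compact R (- r) r.
apply: (@subclosed_compact _ _ (phi @` (`[-r, r]%classic `*` `[-r, r]%classic))).
- rewrite -[X in closed X]setCK; apply: open_closedC.
  have -> : ~` [set z : cplx R | modulus z <= r] = [set z | r < modulus (z - 0)].
    by apply/seteqP; split => z /=; rewrite subr0 ltNge => /negP.
  exact: open_outer.
- apply: continuous_compact; last exact: compact_setX.
  exact: continuous_subspaceT.
- move=> z /= Hz; exists (complex.Re z, complex.Im z); last by case: z Hz.
  split => /=; rewrite in_itv /= -ler_norml.
    exact: le_trans (Re_le_modulus _) Hz.
  exact: le_trans (Im_le_modulus _) Hz.
Qed.

Lemma continuous_horner (p : {poly cplx R}) z (e : R) : 0 < e ->
  exists2 d : R, 0 < d & forall w, modulus (w - z) < d -> modulus (p.[w] - p.[z]) < e.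
Proof.
elim/poly_ind: p e => [|p c IH] e e0.
  by exists 1 => // w _; rewrite !horner0 subrr modulus0.
have z1 : 0 < modulus z + 1 by rewrite ltr_wpDl // modulus_ge0.
have p1 : 0 < modulus p.[z] + 1 by rewrite ltr_wpDl // modulus_ge0.
have [|d d0 Hd] := IH (e / 2 / (modulus z + 1)); first by rewrite !divr_gt0.
have f0 : 0 < e / 2 / (modulus p.[z] + 1) by rewrite !divr_gt0.
exists (Num.min (Num.min d 1) (e / 2 / (modulus p.[z] + 1))).
  by rewrite !lt_min d0 f0 ltr01.
move=> w; rewrite !lt_min => /andP[/andP[/Hd wd w1] we]; rewrite !hornerMXaddC.
have -> : p.[w] * w + c - (p.[z] * z + c) = (p.[w] - p.[z]) * w + p.[z] * (w - z) by ring.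
have wz : modulus w <= modulus z + 1 by have := modulusBr w z; lra.
have := modulusD ((p.[w] - p.[z]) * w) (p.[z] * (w - z)); rewrite !modulusM.
move: wd we; rewrite !ltr_pdivlMr // => wd we.
have H1 : modulus (p.[w] - p.[z]) * modulus w <= modulus (p.[w] - p.[z]) * (modulus z + 1).
  by rewrite ler_wpM2l // modulus_ge0.
have H2 : modulus p.[z] * modulus (w - z) <= modulus (w - z) * (modulus p.[z] + 1).
  by rewrite mulrC ler_wpM2l ?modulus_ge0 // lerDl.
by lra.
Qed.

(** A bound for a rational function on X spreads to a neighbourhood of X in this form. The condition
    on [q] belongs to the set because [x / 0 = 0] would let poles in. *)
Lemma open_horner_lt (p q : {poly cplx R}) (b : R) :
  open [set z | q.[z] != 0 /\ modulus (p.[z] / q.[z]) < b].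
Proof.
apply/open_modulusP => z /= [qz].
rewrite modulusM modulusV ltr_pdivrMr ?modulus_gt0 // => pz.
have q0 : 0 < modulus q.[z] by rewrite modulus_gt0.
have b0 : 0 < b.
  by rewrite -(pmulr_lgt0 _ q0); exact: le_lt_trans (modulus_ge0 _) pz.
(* When both polynomials move by less than [e], the gap [b * |q| - |p|] shrinks by less than
   [e * (b + 1)], which is half of it. *)
pose e := (b * modulus q.[z] - modulus p.[z]) / (2 * (b + 1)).
have e0 : 0 < e by rewrite divr_gt0 ?subr_gt0 // mulr_gt0 // addr_gt0.
have ee : e * (b + 1) * 2 = b * modulus q.[z] - modulus p.[z].
  by rewrite /e; field; lra.
have [d1 d10 H1] := continuous_horner p z e0.
have [d2 d20 H2] := continuous_horner q z e0.
have [d3 d30 H3] := continuous_horner q z q0.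
exists (Num.min (Num.min d1 d2) d3); first by rewrite !lt_min d10 d20.
move=> w; rewrite !lt_min => /andP[/andP[/H1 w1 /H2 w2] /H3 w3].
have qw : q.[w] != 0.
  apply/eqP => qw; move: w3; rewrite qw sub0r modulusN; lra.
split=> //; rewrite modulusM modulusV ltr_pdivrMr ?modulus_gt0 //.
have := modulusBr p.[w] p.[z]; have := modulusBr q.[z] q.[w].
rewrite [modulus (q.[z] - _)]modulusB.
nra.
Qed.

Lemma within_uniform_approx X (f : cplx R -> cplx R) :
  (forall e : R, 0 < e -> exists2 r, {within X, continuous r} &
     forall z, X z -> modulus (f z - r z) < e) -> {within X, continuous f}.
Proof.
move=> H; apply/within_modulusP => z Xz e e0.
have e30 : 0 < e / 3 by rewrite divr_gt0.
have [r /within_modulusP cr fr] := H _ e30.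
have [d d0 Hd] := cr z Xz _ e30; exists d => // w Xw wd.
have H1 := fr _ Xw; have H2 := fr _ Xz; have H3 := Hd _ Xw wd.
have := modulusBD (f w) (f z) (r w); have := modulusBD (r w) (f z) (r z).
rewrite [modulus (r z - f z)]modulusB; lra.
Qed.

(** With [P = p - r(z) q], the quotient [P / q] is [r - r(z)] and vanishes at [z], so that
    continuity at [z] is an instance of [open_horner_lt]. *)
Lemma within_rational X r : rational_functions X r -> {within X, continuous r}.
Proof.
move=> [p [q H]]; apply/within_modulusP => z Xz e e0.
have [qz rz] := H z Xz.
pose P : {poly cplx R} := p - (p.[z] / q.[z])%:P * q.
have Pz : P.[z] = 0 by rewrite !hornerE divfK // subrr.
have /open_modulusP := @open_horner_lt P q e.
move=> /(_ z) []; first by rewrite /= qz Pz mul0r modulus0.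
move=> d d0 Hd; exists d => // w Xw /Hd [qw].
rewrite /P !hornerE mulrBl mulfK // rz.
by have [_ ->] := H w Xw.
Qed.

Lemma rational_algebraP X f :
  rational_algebra X f <-> forall e : R, 0 < e -> exists2 r, rational_functions X r &
      forall z, X z -> modulus (f z - r z) < e.
Proof.
split=> [[_ H] e e0|H].
  have [r rX fr] := H e e0; exists r => // z /fr.
  by rewrite normE ltcR.
split.
  apply: within_uniform_approx => e /H [r rX fr]; exists r => //.
  exact: within_rational.
move=> e /H [r rX fr]; exists r => // z /fr; by rewrite normE ltcR.
Qed.

Lemma compact_increasing_cover X (U : nat -> set (cplx R)) : compact X ->
  (forall n, open (U n)) -> (forall m n, (m <= n)%N -> U m `<=` U n) ->
  X `<=` \bigcup_n U n -> exists n, X `<=` U n.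
Proof.
rewrite compact_cover => cX oU mU XU.
have [|D _ XD] := cX nat setT U _ XU; first by move=> n _; exact: oU.
exists (\max_(n <- finmap.enum_fset D) n)%N => z /XD [n /= nD]; apply: mU.
exact: (@leq_bigmax_seq nat (finmap.enum_fset D) xpredT id n nD isT).
Qed.

Lemma compact_bounded_modulus X f : compact X -> {within X, continuous f} ->
  exists2 B : R, 0 < B & forall z, X z -> modulus (f z) < B.
Proof.
move=> cX /within_modulusP cf.
have [|||n Hn] := @compact_increasing_cover X (fun n => [set z | exists2 d : R, 0 < d &
   forall w, X w -> modulus (w - z) < d -> modulus (f w) < n%:R]) cX.
- move=> n; apply/open_modulusP => z [d d0 Hd].
  exists (d / 2); first by rewrite divr_gt0.
  move=> w wz /=; exists (d / 2); first by rewrite divr_gt0.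
  move=> u Xu uw; apply: Hd => //.
  by have := modulusBD u z w; lra.
- move=> m n mn z [d d0 Hd]; exists d => // w Xw wd.
  by apply: lt_le_trans (Hd w Xw wd) _; rewrite ler_nat.
- move=> z Xz.
  have [d d0 Hd] := cf z Xz 1 ltr01.
  exists (Num.truncn (modulus (f z) + 1)).+1 => //=; exists d => // w Xw wd.
  have wz := Hd w Xw wd.
  have t0 : 0 <= modulus (f z) + 1 by rewrite addr_ge0 // modulus_ge0.
  have /andP[_] := truncn_itv t0.
  by apply: le_lt_trans; have := modulusBr (f w) (f z); lra.
exists n.+1%:R => // z Xz; have [d d0 Hd] := Hn z Xz.
have := Hd z Xz; rewrite subrr modulus0 => /(_ d0) H; apply: lt_le_trans H _.
by rewrite ler_nat.
Qed.

End Topology.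

(** * Means over roots of unity *)

Lemma exists_prim_root (F : numClosedFieldType) n :
  (n > 0)%N -> exists z : F, n.-primitive_root z.
Proof.
pose p : {poly F} := 'X^n - 1; have [r Dp] := closed_field_poly_normal p.
move=> n_gt0; rewrite (monicP _) ?monicXnsubC // scale1r in Dp.
have rn1 : all n.-unity_root r by apply/allP => z; rewrite -root_prod_XsubC -Dp.
have sz_r : (n < (size r).+1)%N.
  by rewrite -(size_prod_XsubC r id) -Dp size_XnsubC.
have [|z] := hasP (cyclic.has_prim_root n_gt0 rn1 _ sz_r); last by exists z.
by rewrite -separable.separable_prod_XsubC -Dp cyclotomic.separable_Xn_sub_1 // pnatr_eq0 -lt0n.
Qed.

Section CircleMeans.
Variable R : realType.
Local Notation C := (cplx R).
Implicit Types (z w a : C) (u v : nat -> C) (phi psi : C -> C).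

(** The order is [n.+1], hence never 0; the means below are taken over [n.+1] points and kill
    [z ^+ k] for [0 < k <= n]. *)
Definition zeta n : C := sval (cid (exists_prim_root C (ltn0Sn n))).

Lemma zetaP n : n.+1.-primitive_root (zeta n).
Proof. by rewrite /zeta; case: cid. Qed.

Lemma modulus_unity_root n z : (n > 0)%N -> modulus (z ^+ n) = 1 -> modulus z = 1.
Proof.
move=> n0; rewrite modulusX => H; apply/eqP.
by rewrite -(pexpr_eq1 n0) ?modulus_ge0 ?H.
Qed.

Lemma modulus_zeta n i : modulus (zeta n ^+ i) = 1.
Proof.
apply: (@modulus_unity_root n.+1) => //.
by rewrite -exprM mulnC exprM (prim_expr_order (zetaP n)) expr1n modulus1.
Qed.

Lemma sum_zeta n k : (0 < k <= n)%N -> \sum_(i < n.+1) (zeta n ^+ i) ^+ k = 0.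
Proof.
move=> /andP[k0 kn].
have zk : zeta n ^+ k != 1.
  rewrite -(expr0 (zeta n)) (eq_prim_root_expr (zetaP n)) mod0n modn_small //.
  by rewrite -lt0n.
have := subrX1 (zeta n ^+ k) n.+1.
rewrite -exprM mulnC exprM (prim_expr_order (zetaP n)) expr1n subrr => /esym /eqP.
rewrite mulf_eq0 subr_eq0 (negPf zk) /= => /eqP H.
by rewrite -[RHS]H; apply: eq_bigr => i _; rewrite -!exprM mulnC.
Qed.

Definition converges u (l : C) := forall e : R, 0 < e ->
  exists N, forall n, (N <= n)%N -> modulus (u n - l) < e.

Lemma converges_ext u v l : (forall n, u n = v n) -> converges u l -> converges v l.
Proof. by move=> uv H e /H [N HN]; exists N => n /HN; rewrite uv. Qed.

Lemma converges_cst l : converges (fun=> l) l.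
Proof. by move=> e e0; exists 0%N => n _; rewrite subrr modulus0. Qed.

Lemma convergesD u v l m : converges u l -> converges v m ->
  converges (fun n => u n + v n) (l + m).
Proof.
move=> ul vm e e0; have e20 : 0 < e / 2 by rewrite divr_gt0.
have [N HN] := ul _ e20; have [M HM] := vm _ e20.
exists (maxn N M) => n; rewrite geq_max => /andP[/HN un /HM vn].
by have := modulusD (u n - l) (v n - m); rewrite addrACA -opprD; lra.
Qed.

Lemma convergesZ a u l : converges u l -> converges (fun n => a * u n) (a * l).
Proof.
move=> ul e e0; have a1 : 0 < modulus a + 1 by rewrite ltr_wpDl // modulus_ge0.
have [|N HN] := ul (e / (modulus a + 1)); first by rewrite divr_gt0.
exists N => n /HN; rewrite ltr_pdivlMr // -mulrBr modulusM => H.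
by apply: le_lt_trans H; rewrite mulrC ler_wpM2l ?modulus_ge0 // lerDl.
Qed.

Lemma convergesB u v l m : converges u l -> converges v m ->
  converges (fun n => u n - v n) (l - m).
Proof.
move=> ul /(convergesZ (-1)) vm; rewrite -[- m]mulN1r.
by apply: converges_ext (convergesD ul vm) => n; rewrite mulN1r.
Qed.

Lemma converges_sum (I : eqType) (r : seq I) (f : I -> nat -> C) (l : I -> C) :
  (forall i, i \in r -> converges (f i) (l i)) ->
  converges (fun n => \sum_(i <- r) f i n) (\sum_(i <- r) l i).
Proof.
elim: r => [_|i r IH' H].
  rewrite big_nil; apply: converges_ext (converges_cst 0) => n.
  by rewrite big_nil.
have IH := IH' (fun j jr => H j (mem_behead (s := i :: r) jr)).
rewrite big_cons; apply: converges_ext (convergesD (H i (mem_head i r)) IH) => n.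
by rewrite big_cons.
Qed.

Lemma converges_approx u l : (forall e : R, 0 < e -> exists v, converges v l /\
  forall n, modulus (u n - v n) <= e) -> converges u l.
Proof.
move=> H e e0; have e20 : 0 < e / 2 by rewrite divr_gt0.
have [v [vl uv]] := H _ e20; have [N HN] := vl _ e20; exists N => n /HN vn.
by have := modulusBD (u n) l (v n); have := uv n; lra.
Qed.

Lemma converges_modulus_le u l (b : R) : converges u l ->
  (forall n, modulus (u n) <= b) -> modulus l <= b.
Proof.
move=> ul ub; rewrite leNgt; apply/negP => bl.
have [|N HN] := ul (modulus l - b); first by rewrite subr_gt0.
have := HN N (leqnn N); rewrite modulusB.
by have := modulusBr l (u N); have := ub N; lra.
Qed.

Definition mean phi n : C := n.+1%:R^-1 * \sum_(i < n.+1) phi (zeta n ^+ i).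

Lemma eq_mean phi psi n : (forall z, modulus z = 1 -> phi z = psi z) ->
  mean phi n = mean psi n.
Proof.
by move=> H; congr (_ * _); apply: eq_bigr => i _; rewrite H // modulus_zeta.
Qed.

Lemma meanD phi psi n : mean (fun z => phi z + psi z) n = mean phi n + mean psi n.
Proof. by rewrite /mean big_split mulrDr. Qed.

Lemma meanZ a phi n : mean (fun z => a * phi z) n = a * mean phi n.
Proof. by rewrite /mean -mulr_sumr mulrCA. Qed.

Lemma mean_le phi n (b : R) : (forall z, modulus z = 1 -> modulus (phi z) <= b) ->
  modulus (mean phi n) <= b.
Proof.
move=> H; rewrite modulusM modulusV modulus_nat ler_pdivrMl ?ltr0n //.
apply: le_trans (modulus_sum _ _ _) _.
apply: le_trans (_ : \sum_(i < n.+1) b <= _).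
  by apply: ler_sum => i _; rewrite H // modulus_zeta.
by rewrite sumr_const card_ord mulr_natl.
Qed.

Lemma mean_cst a n : mean (fun=> a) n = a.
Proof.
by rewrite /mean sumr_const card_ord -[a *+ _]mulr_natl mulKf // pnatr_eq0.
Qed.

Lemma mean_pow k n : (0 < k <= n)%N -> mean (fun z => z ^+ k) n = 0.
Proof. by move=> /sum_zeta H; rewrite /mean H mulr0. Qed.

(** Inversion permutes the roots of unity: the inverse of [zeta ^+ i] is [zeta * zeta ^+ (n - i)],
    and [n - i] is [rev_ord i]. *)
Lemma mean_powV k n : (0 < k <= n)%N -> mean (fun z => z^-1 ^+ k) n = 0.
Proof.
case/andP=> k0 kn; rewrite /mean.
rewrite (eq_bigr (fun i : 'I_n.+1 => zeta n ^+ k * (zeta n ^+ rev_ord i) ^+ k)).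
  by rewrite -mulr_sumr (reindex_inj rev_ord_inj) /=;
    under eq_bigr do rewrite subSS subKn ?leq_ord //; rewrite sum_zeta ?k0 // !mulr0.
move=> i _; have z0 : zeta n != 0 by rewrite -modulus_gt0 -(expr1 (zeta n)) modulus_zeta.
have : zeta n ^+ (i + rev_ord i).+1 = 1.
  by rewrite /= subSS subnKC ?leq_ord //; exact: (prim_expr_order (zetaP n)).
rewrite -addSn exprD exprS mulrAC => H.
rewrite -exprMn; congr (_ ^+ _).
have zi : zeta n ^+ i != 0 by rewrite expf_neq0.
by apply: (mulIf zi); rewrite mulVf // mulrAC mulrA -H; ring.
Qed.

(* The geometric series reduces means against [1 / (1 - a chi)] to means against powers of [chi]. *)
Definition null_against (chi phi : C -> C) :=
  forall j, converges (mean (fun z => chi z ^+ j * phi z)) 0.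

(** Cut at order [J], the geometric series leaves a remainder of modulus at most
    [|a|^J * b / (1 - |a|)] on the whole circle, hence also in every mean. [chi] will be the
    identity for a pole outside the circle and the inversion for a pole inside. *)
Lemma null_against_geometric (chi phi : C -> C) a (b : R) :
  modulus a < 1 -> (forall z, modulus z = 1 -> modulus (chi z) = 1) ->
  (forall z, modulus z = 1 -> modulus (phi z) <= b) ->
  null_against chi phi -> null_against chi (fun z => phi z / (1 - a * chi z)).
Proof.
move=> a1 chi1 phib H j; apply: converges_approx => e e0.
have b0 : 0 <= b by apply: le_trans (modulus_ge0 _) (phib 1 _); rewrite modulus1.
have [J HJ] : exists J, modulus a ^+ J * (b / (1 - modulus a)) <= e.
  have : modulus a ^+ n * (b / (1 - modulus a)) @[n --> \oo] --> 0.
    by rewrite -[X in _ --> X](mul0r (b / (1 - modulus a))); apply: cvgMl;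
      apply: cvg_expr; rewrite ger0_norm ?modulus_ge0.
  move=> /cvgrPdist_le /(_ _ e0) [J _ HJ]; exists J.
  by have := HJ J (leqnn J); rewrite sub0r normrN; apply: le_trans; exact: ler_norm.
exists (mean (fun z => \sum_(i < J) a ^+ i * (chi z ^+ (j + i) * phi z))); split.
  have E0 : \sum_(i < J) a ^+ i * 0 = 0 :> C by rewrite big1 // => i _; rewrite mulr0.
  rewrite -[X in converges _ X]E0.
  have := @converges_sum _ (index_enum 'I_J) _ _ (fun (i : 'I_J) _ => convergesZ (a ^+ i) (H (j + i)%N)).
  apply: converges_ext => n.
  rewrite /mean /= [in RHS]exchange_big /= mulr_sumr; apply: eq_bigr => i _.
  by rewrite -mulr_sumr mulrCA.
move=> n; rewrite -[X in _ - X]mul1r -mulNr -meanZ -meanD.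
apply: mean_le => z z1.
have az : modulus (a * chi z) = modulus a by rewrite modulusM chi1 // mulr1.
have az1 : 1 - a * chi z != 0.
  rewrite subr_eq0; apply/eqP => E; move: az; rewrite -E modulus1 => E'.
  by move: a1; rewrite -E' ltxx.
have -> : chi z ^+ j * (phi z / (1 - a * chi z)) +
   -1 * (\sum_(i < J) a ^+ i * (chi z ^+ (j + i) * phi z)) =
   chi z ^+ j * phi z * (a * chi z) ^+ J / (1 - a * chi z).
  rewrite (eq_bigr (fun i : 'I_J => chi z ^+ j * phi z * (a * chi z) ^+ i)); last first.
    by move=> i _; rewrite exprD exprMn; ring.
  rewrite -mulr_sumr; apply: (mulIf az1); rewrite mulrDl !divfK //.
  have := subrX1 (a * chi z) J; set S := \sum_(i < J) _.
  move=> E; have -> : (a * chi z) ^+ J = 1 + (a * chi z - 1) * S by rewrite -E; ring.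
  by rewrite mulrA divfK //; ring.
rewrite !modulusM modulusV !modulusX az chi1 // expr1n mul1r.
apply: le_trans HJ; rewrite [modulus (phi z) * _]mulrC -mulrA.
rewrite ler_wpM2l ?exprn_ge0 ?modulus_ge0 //.
apply: ler_pM; rewrite ?invr_ge0 ?modulus_ge0 ?phib //.
rewrite lef_pV2 ?posrE ?subr_gt0 //; last by rewrite modulus_gt0.
by have := modulusBr 1 (a * chi z); rewrite modulus1 az.
Qed.

End CircleMeans.

(** * Riemann sums of contour integrals *)

Section PartialFractions.
Variables (F : fieldType) (A : set F).

(** [A] is the set of allowed poles. A closure under linear combinations replaces explicit
    expansions, since only linear statements are proved about them; equality is asked off [A] only,
    the values at the poles being conventional. *)
Inductive partial_fraction : (F -> F) -> Prop :=
| partial_fraction_poly (q : {poly F}) : partial_fraction (fun w => q.[w])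
| partial_fraction_pole p k : A p -> partial_fraction (fun w => (w - p)^-1 ^+ k.+1)
| partial_fractionD G H : partial_fraction G -> partial_fraction H ->
    partial_fraction (fun w => G w + H w)
| partial_fractionZ a G : partial_fraction G -> partial_fraction (fun w => a * G w)
| partial_fraction_ext G H : (forall w, ~ A w -> G w = H w) ->
    partial_fraction G -> partial_fraction H.

(** For distinct poles, [1/((w - p)(w - p')) = (1/(w - p) - 1/(w - p')) / (p - p')] lowers the
    exponent by one. *)
Lemma partial_fraction_pole_div p p' k : A p -> A p' ->
  partial_fraction (fun w => (w - p)^-1 ^+ k.+1 / (w - p')).
Proof.
move=> Ap Ap'; have [<-|pp'] := eqVneq p p'.
  apply: partial_fraction_ext (partial_fraction_pole k.+1 Ap) => w _.
  by rewrite exprSr.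
have d0 : p - p' != 0 by rewrite subr_eq0.
elim: k => [|k IH].
  apply: (partial_fraction_ext (G := fun w =>
    (p - p')^-1 * ((w - p)^-1 ^+ 1 + -1 * (w - p')^-1 ^+ 1))); last first.
    by apply: partial_fractionZ; apply: partial_fractionD; [|apply: partial_fractionZ];
      exact: partial_fraction_pole.
  move=> w Aw; rewrite !expr1.
  have w0 : w - p != 0 by rewrite subr_eq0; apply/eqP => E; apply: Aw; rewrite E.
  have w0' : w - p' != 0 by rewrite subr_eq0; apply/eqP => E; apply: Aw; rewrite E.
  by field; rewrite d0 w0 w0'.
apply: (partial_fraction_ext (G := fun w =>
    (p - p')^-1 * ((w - p)^-1 ^+ k.+2 + -1 * ((w - p)^-1 ^+ k.+1 / (w - p'))))); last first.
  apply: partial_fractionZ; apply: partial_fractionD; first exact: partial_fraction_pole.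
  exact: partial_fractionZ.
move=> w Aw.
have w0 : w - p != 0 by rewrite subr_eq0; apply/eqP => E; apply: Aw; rewrite E.
have w0' : w - p' != 0 by rewrite subr_eq0; apply/eqP => E; apply: Aw; rewrite E.
rewrite [(w - p)^-1 ^+ k.+2]exprSr; set X := (w - p)^-1 ^+ k.+1.
by field; rewrite d0 w0 w0'.
Qed.

Lemma partial_fraction_div G p : A p -> partial_fraction G ->
  partial_fraction (fun w => G w / (w - p)).
Proof.
move=> Ap; elim=> [q|p' k Ap'|G1 G2 _ H1 _ H2|a G1 _ H1|G1 G2 G12 _ H1].
- have /factor_theorem [s qs] : root (q - q.[p]%:P) p by rewrite /root !hornerE subrr.
  apply: (partial_fraction_ext (G := fun w => s.[w] + q.[p] * (w - p)^-1 ^+ 1)); last first.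
    apply: partial_fractionD; first exact: partial_fraction_poly.
    by apply: partial_fractionZ; exact: partial_fraction_pole.
  move=> w Aw.
  have w0 : w - p != 0 by rewrite subr_eq0; apply/eqP => E; apply: Aw; rewrite E.
  have -> : q.[w] = s.[w] * (w - p) + q.[p].
    by have := congr1 (horner^~ w) qs; rewrite /= !hornerE => /eqP; rewrite subr_eq => /eqP.
  by rewrite expr1; field.
- exact: partial_fraction_pole_div.
- by apply: partial_fraction_ext (partial_fractionD H1 H2) => w _; rewrite mulrDl.
- by apply: partial_fraction_ext (partial_fractionZ a H1) => w _; rewrite mulrA.
- by apply: partial_fraction_ext H1 => w /G12 ->.
Qed.

Lemma partial_fraction_rational (q : {poly F}) (ps : seq F) :
  (forall p, p \in ps -> A p) ->
  partial_fraction (fun w => q.[w] / \prod_(p <- ps) (w - p)).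
Proof.
elim: ps => [|p ps IH] H.
  by apply: partial_fraction_ext (partial_fraction_poly q) => w _; rewrite big_nil divr1.
have Ap : A p by apply: H; rewrite mem_head.
have /(partial_fraction_div Ap) : partial_fraction (fun w => q.[w] / \prod_(p <- ps) (w - p)).
  by apply: IH => p' p'ps; apply: H; rewrite in_cons p'ps orbT.
apply: partial_fraction_ext => w _; rewrite big_cons invfM; ring.
Qed.

End PartialFractions.

Section Contours.
Variable R : realType.
Local Notation C := (cplx R).
Implicit Types (c p w x a : C) (r S : R) (G H K g : C -> C).

Lemma null_against_geometricX (chi phi : C -> C) a (b : R) k :
  modulus a < 1 -> (forall z, modulus z = 1 -> modulus (chi z) = 1) ->
  (forall z, modulus z = 1 -> modulus (phi z) <= b) ->
  null_against chi phi -> null_against chi (fun z => phi z * (1 - a * chi z)^-1 ^+ k).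
Proof.
move=> a1 chi1 phib H.
(* Each division requires a bound on the circle for the function divided, so the bound is carried
   through the induction. *)
suff: null_against chi (fun z => phi z * (1 - a * chi z)^-1 ^+ k) /\
  forall z, modulus z = 1 ->
    modulus (phi z * (1 - a * chi z)^-1 ^+ k) <= b * (1 - modulus a)^-1 ^+ k by case.
elim: k => [|k [IH1 IH2]].
  split=> [j|z z1]; last by rewrite !expr0 !mulr1 phib.
  by apply: converges_ext (H j) => n; apply: eq_mean => z _; rewrite expr0 mulr1.
split.
  move=> j; have := null_against_geometric a1 chi1 IH2 IH1 j.
  by apply: converges_ext => n; apply: eq_mean => z _; rewrite exprSr; congr (_ * _); rewrite mulrA.
move=> z z1; rewrite !exprSr !mulrA modulusM.
apply: ler_pM; rewrite ?modulus_ge0 ?IH2 // modulusV.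
have /lt0r_neq0 : 0 < 1 - modulus a by rewrite subr_gt0.
have := modulusBr 1 (a * chi z); rewrite modulus1 modulusM chi1 // mulr1 => H1 _.
rewrite lef_pV2 ?posrE ?subr_gt0 //.
by apply: lt_le_trans H1; rewrite subr_gt0.
Qed.

(* Riemann sums of [(2 i pi)^-1 * \oint G] along the circle of centre [c] and radius [r]. *)
Definition circle_sum c r G n := mean (fun z => r%:C * z * G (c + r%:C * z)) n.

Lemma circle_sumD c r G H n :
  circle_sum c r (fun w => G w + H w) n = circle_sum c r G n + circle_sum c r H n.
Proof. by rewrite /circle_sum -meanD; apply: eq_mean => z _; rewrite mulrDr. Qed.

Lemma circle_sumZ c r a G n :
  circle_sum c r (fun w => a * G w) n = a * circle_sum c r G n.
Proof. by rewrite /circle_sum -meanZ; apply: eq_mean => z _; rewrite mulrCA. Qed.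

Lemma modulus_circle c r z : 0 <= r -> modulus z = 1 -> modulus (c + r%:C * z - c) = r.
Proof.
by move=> r0 z1; rewrite addrC addKr modulusM modulus_real z1 mulr1 ger0_norm.
Qed.

Lemma eq_circle_sum c r G H n : 0 <= r ->
  (forall w, modulus (w - c) = r -> G w = H w) -> circle_sum c r G n = circle_sum c r H n.
Proof.
by move=> r0 GH; apply: eq_mean => z z1; rewrite GH // modulus_circle.
Qed.

Lemma circle_sum_le c r G n (b : R) : 0 <= r ->
  (forall w, modulus (w - c) = r -> modulus (G w) <= b) ->
  modulus (circle_sum c r G n) <= r * b.
Proof.
move=> r0 Gb; apply: mean_le => z z1; rewrite modulusM modulusM modulus_real z1 mulr1.
by rewrite ger0_norm // ler_wpM2l // Gb // modulus_circle.
Qed.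

Lemma circle_sum_poly c r (q : {poly C}) : converges (circle_sum c r (horner q)) 0.
Proof.
pose s : {poly C} := q \Po (r%:C *: 'X + c%:P).
have E0 : \sum_(i < size s) r%:C * s`_i * 0 = 0 :> C by rewrite big1 // => i _; rewrite mulr0.
rewrite -[X in converges _ X]E0.
have H (i : 'I_(size s)) : converges (mean (fun z : C => z ^+ i.+1)) 0.
  move=> e e0; exists i.+1 => n ni; rewrite mean_pow ?ni // subrr modulus0 //.
have := @converges_sum _ _ (index_enum 'I_(size s)) _ _
  (fun (i : 'I_(size s)) _ => convergesZ (r%:C * s`_i) (H i)).
apply: converges_ext => n; rewrite /circle_sum /mean.
under eq_bigr do rewrite mulrCA mulr_sumr.
rewrite -mulr_sumr exchange_big /=; congr (_ * _); apply: eq_bigr => i _.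
have -> : q.[c + r%:C * zeta R n ^+ i] = s.[zeta R n ^+ i].
  by rewrite /s horner_comp !hornerE addrC.
rewrite horner_coef mulr_sumr; apply: eq_bigr => j _.
by rewrite exprS; ring.
Qed.

(** On the circle [w - p = (c - p) * (1 - a * z)] with [|a| < 1]: the series in [z] has positive
    powers only, once multiplied by the factor [r * z] of the line element. *)
Lemma circle_sum_pole_out c r p k : 0 <= r -> r < modulus (p - c) ->
  converges (circle_sum c r (fun w => (w - p)^-1 ^+ k)) 0.
Proof.
move=> r0 rp; have pc : 0 < modulus (p - c) by apply: le_lt_trans rp.
have pc0 : p - c != 0 by rewrite -modulus_gt0.
pose a := r%:C / (p - c).
have a1 : modulus a < 1.
  by rewrite modulusM modulusV modulus_real ger0_norm // ltr_pdivrMr // mul1r.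
have b1 (z : C) : modulus z = 1 -> modulus (r%:C * (c - p)^-1 ^+ k * z) <= modulus (r%:C * (c - p)^-1 ^+ k).
  by move=> z1; rewrite modulusM z1 mulr1.
have H0 : null_against id (fun z => r%:C * (c - p)^-1 ^+ k * z).
  move=> j; rewrite -[X in converges _ X](mulr0 (r%:C * (c - p)^-1 ^+ k)).
  have := @convergesZ _ (r%:C * (c - p)^-1 ^+ k) (mean (fun z : C => z ^+ j.+1)) 0.
  move=> H; apply: converges_ext (H _) => [n|].
    by rewrite -meanZ; apply: eq_mean => z _; rewrite exprSr; ring.
  by move=> e e0; exists j.+1 => n nj; rewrite mean_pow ?nj // subrr modulus0.
have := null_against_geometricX k a1 (fun z => id) b1 H0 0.
apply: converges_ext => n; apply: eq_mean => z z1; rewrite mul1r.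
have -> : c + r%:C * z - p = (c - p) * (1 - a * z).
  by rewrite /a; field.
by rewrite invfM exprMn; ring.
Qed.

(** On the circle [w - p = r * z * (1 - u / z)] with [|u| < 1]. After multiplication by [r * z], the
    series in [1 / z] has a constant term, equal to 1, only for a simple pole: this is the
    residue. *)
Lemma circle_sum_pole_in c r p k : modulus (p - c) < r ->
  converges (circle_sum c r (fun w => (w - p)^-1 ^+ k.+1)) (k == 0%N)%:R.
Proof.
move=> pr; have r0 : 0 < r by apply: le_lt_trans pr; exact: modulus_ge0.
have rC : r%:C != 0 by rewrite -modulus_gt0 modulus_real normr_gt0 gt_eqF.
pose u := (p - c) / r%:C.
have u1 : modulus u < 1.
  by rewrite modulusM modulusV modulus_real gtr0_norm // ltr_pdivrMr // mul1r.
have inv1 (z : C) : modulus z = 1 -> modulus z^-1 = 1.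
  by move=> z1; rewrite modulusV z1 invr1.
have nullV j : (0 < j)%N -> converges (mean (fun z : C => z^-1 ^+ j)) 0.
  by move=> j0 e e0; exists j => n nj; rewrite mean_powV ?nj ?j0 // subrr modulus0.
have nullA j (b : C) : (0 < j)%N -> null_against (@GRing.inv C) (fun z => b * z^-1 ^+ j).
  move=> j0 i; rewrite -[X in converges _ X](mulr0 b).
  apply: converges_ext (convergesZ b (nullV (i + j)%N _)) => [n|]; last by rewrite addn_gt0 j0 orbT.
  by rewrite -meanZ; apply: eq_mean => z _; rewrite exprD; ring.
have bnd j (b z : C) : modulus z = 1 -> modulus (b * z^-1 ^+ j) <= modulus b.
  by move=> z1; rewrite modulusM modulusX inv1 // expr1n mulr1.
have E (z : C) : modulus z = 1 -> c + r%:C * z - p = r%:C * z * (1 - u * z^-1).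
  move=> z1; have z0 : z != 0 by rewrite -modulus_gt0 z1.
  by rewrite /u; field; rewrite z0 rC.
case: k => [|k] /=.
  have := convergesD (converges_cst (1 : C))
    (null_against_geometricX 1 u1 inv1 (bnd 1%N u) (nullA 1%N u isT) 0).
  rewrite addr0; apply: converges_ext => n.
  rewrite -[X in X + _ = _](mean_cst 1 n) -meanD; apply: eq_mean => z z1.
  have z0 : z != 0 by rewrite -modulus_gt0 z1.
  have d0 : 1 - u * z^-1 != 0.
    rewrite subr_eq0; apply/eqP => /(congr1 (@modulus R)).
    rewrite modulusM inv1 // modulus1 mulr1 => E1; by move: u1; rewrite -E1 ltxx.
  rewrite E // !expr1 expr0 mul1r.
  have zu : z - u != 0.
    by apply: contraNneq d0 => /eqP; rewrite subr_eq0 => /eqP <-; rewrite mulfV // subrr.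
  by field; rewrite rC z0 zu.
have := null_against_geometricX k.+2 u1 inv1 (bnd k.+1 (r%:C^-1 ^+ k.+1)) (nullA k.+1 (r%:C^-1 ^+ k.+1) isT) 0.
apply: converges_ext => n; apply: eq_mean => z z1.
have z0 : z != 0 by rewrite -modulus_gt0 z1.
rewrite E // expr0 mul1r !invfM !exprMn [r%:C^-1 ^+ k.+2]exprS [z^-1 ^+ k.+2]exprS.
set X := _ ^+ k.+2; set Y := _ ^+ k.+1; set Z := _ ^+ k.+1.
by field; rewrite rC z0.
Qed.

End Contours.

(** * Cauchy's formula in a disc from which finitely many disjoint discs are removed *)

Section CauchyEstimate.
Variable R : realType.
Local Notation C := (cplx R).
Implicit Types (c p w x a : C) (r : R) (d : C * R) (ds : seq (C * R)) (G H : C -> C).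

Definition disjoint_discs d d' := d.2 + d'.2 <= modulus (d.1 - d'.1).

Lemma disjoint_discsC d d' : disjoint_discs d d' = disjoint_discs d' d.
Proof. by rewrite /disjoint_discs addrC modulusB. Qed.

Variables (S : R) (ds : seq (C * R)).
Hypothesis S_gt0 : 0 < S.
Hypothesis ds_ge0 : forall d, d \in ds -> 0 <= d.2.
Hypothesis ds_in : forall d, d \in ds -> modulus d.1 + d.2 <= S.
Hypothesis ds_disjoint : pairwise disjoint_discs ds.

(** The admissible positions of the poles: the complement of the closed domain bounded by the
    contour. *)
Definition off_contour p := S < modulus p \/ exists2 d, d \in ds & modulus (p - d.1) < d.2.

Definition contour_sum G n :=
  circle_sum 0 S G n - \sum_(d <- ds) circle_sum d.1 d.2 G n.

Lemma contour_sumD G H n :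
  contour_sum (fun w => G w + H w) n = contour_sum G n + contour_sum H n.
Proof.
rewrite /contour_sum circle_sumD; under eq_bigr do rewrite circle_sumD.
by rewrite big_split /=; ring.
Qed.

Lemma contour_sumZ a G n : contour_sum (fun w => a * G w) n = a * contour_sum G n.
Proof.
rewrite /contour_sum circle_sumZ; under eq_bigr do rewrite circle_sumZ.
by rewrite -mulr_sumr mulrBr.
Qed.

Lemma ds_cases d d' : d \in ds -> d' \in ds -> d = d' \/ disjoint_discs d d'.
Proof.
elim: ds ds_disjoint => // e s IH /= /andP[/allP es ps].
rewrite !inE => /orP[/eqP ->|ds1] /orP[/eqP ->|ds2]; first by left.
- by right; apply: es.
- by right; rewrite disjoint_discsC; apply: es.
- exact: IH.
Qed.

Lemma disjoint_rem d e : d \in ds -> e \in rem d ds -> disjoint_discs d e.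
Proof.
elim: ds ds_disjoint => // h s IH /= /andP[/allP hs ps].
rewrite in_cons; have [-> _|hd /= ds1] := eqVneq d h.
  exact: hs.
rewrite in_cons => /orP[/eqP ->|]; last exact: IH.
by rewrite disjoint_discsC; apply: hs.
Qed.

Lemma off_contour_outer w : off_contour w -> modulus w != S.
Proof.
case=> [|[d dds]]; first by move=> /gt_eqF ->.
have := ds_in dds; have := modulusBr w d.1 => H1 H2 H3.
by rewrite lt_eqF //; lra.
Qed.

Lemma off_contour_inner w d : off_contour w -> d \in ds -> modulus (w - d.1) != d.2.
Proof.
move=> [Sw|[d' d'ds wd']] dds.
  have := ds_in dds; have := modulusBr w d.1 => H1 H2.
  by rewrite gt_eqF //; lra.
have [<-|] := ds_cases d'ds dds; first by rewrite lt_eqF.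
rewrite /disjoint_discs => H; rewrite gt_eqF //.
by have := modulusBD d'.1 d.1 w; rewrite [modulus (d'.1 - w)]modulusB; lra.
Qed.

Lemma contour_sum_ext G H n : (forall w, ~ off_contour w -> G w = H w) ->
  contour_sum G n = contour_sum H n.
Proof.
move=> GH; congr (_ - _).
  apply: eq_circle_sum; first exact: ltW.
  move=> w; rewrite subr0 => wS; apply: GH => /off_contour_outer.
  by rewrite wS eqxx.
rewrite big_seq [RHS]big_seq; apply: eq_bigr => d dds.
apply: eq_circle_sum; first exact: ds_ge0.
move=> w wd; apply: GH => /off_contour_inner /(_ dds).
by rewrite wd eqxx.
Qed.

Lemma converges_discs_out (s : seq (C * R)) p k : (forall d, d \in s -> 0 <= d.2) ->
  (forall d, d \in s -> d.2 < modulus (p - d.1)) ->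
  converges (fun n => \sum_(d <- s) circle_sum d.1 d.2 (fun w => (w - p)^-1 ^+ k) n) 0.
Proof.
elim: s => [|d s IH] s0 sp.
  by apply: converges_ext (converges_cst 0) => n; rewrite big_nil.
rewrite -[X in converges _ X](addr0 0).
have H1 := circle_sum_pole_out k (s0 d (mem_head _ _)) (sp d (mem_head _ _)).
have H2 : converges (fun n => \sum_(d <- s) circle_sum d.1 d.2 (fun w => (w - p)^-1 ^+ k) n) 0.
  by apply: IH => e es; [apply: s0|apply: sp]; rewrite in_cons es orbT.
by apply: converges_ext (convergesD H1 H2) => n; rewrite big_cons.
Qed.

(** A pole in a removed disc has the same residue for the outer circle and for the circle of that
    disc, and these two cancel; the other circles do not enclose it. *)
Lemma contour_sum_pole p k : off_contour p ->
  converges (contour_sum (fun w => (w - p)^-1 ^+ k.+1)) 0.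
Proof.
move=> [Sp|[d dds pd]].
  rewrite -[X in converges _ X](subrr 0); apply: convergesB.
    by apply: circle_sum_pole_out; rewrite ?subr0 // ltW.
  apply: converges_discs_out => [d /ds_ge0 //|d dds].
  by have := ds_in dds; have := modulusBr p d.1; lra.
rewrite -[X in converges _ X](subrr (k == 0%N)%:R); apply: convergesB.
  apply: circle_sum_pole_in; rewrite subr0.
  by have := ds_in dds; have := modulusBr p d.1; lra.
have pe : perm_eq ds (d :: rem d ds) by exact: perm_to_rem.
rewrite -[X in converges _ X](addr0 (k == 0%N)%:R).
apply: converges_ext (convergesD (circle_sum_pole_in k pd)
    (converges_discs_out (s := rem d ds) (p := p) k.+1 _ _)) => [n|e /mem_rem /ds_ge0 //|e ers].
  by rewrite (perm_big _ pe) big_cons.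
have := disjoint_rem dds ers; rewrite /disjoint_discs => H.
by have := modulusBD d.1 e.1 p; rewrite [modulus (d.1 - p)]modulusB; lra.
Qed.

Lemma contour_sum_poly (q : {poly C}) : converges (contour_sum (horner q)) 0.
Proof.
have E0 : 0 - \sum_(d <- ds) 0 = 0 :> C by rewrite big1 // subrr.
rewrite -[X in converges _ X]E0; apply: convergesB; first exact: circle_sum_poly.
by apply: converges_sum => d _; exact: circle_sum_poly.
Qed.

Lemma contour_sum_partial_fraction G :
  partial_fraction off_contour G -> converges (contour_sum G) 0.
Proof.
elim=> [q|p k|G1 G2 _ H1 _ H2|a G1 _ H1|G1 G2 G12 _ H1].
- exact: contour_sum_poly.
- exact: contour_sum_pole.
- rewrite -[X in converges _ X](addr0 0).
  by apply: converges_ext (convergesD H1 H2) => n; rewrite contour_sumD.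
- rewrite -[X in converges _ X](mulr0 a).
  by apply: converges_ext (convergesZ a H1) => n; rewrite contour_sumZ.
- by apply: converges_ext H1 => n; exact: contour_sum_ext.
Qed.

Lemma contour_sum_rational (p q : {poly C}) : (forall w, root q w -> off_contour w) -> q != 0 ->
  converges (contour_sum (fun w => p.[w] / q.[w])) 0.
Proof.
move=> qoff q0; apply: contour_sum_partial_fraction.
have [rs qE] := closed_field_poly_normal q.
apply: partial_fraction_ext (partial_fraction_rational (A := off_contour)
    ((lead_coef q)^-1 *: p) (ps := rs) _) => [w _|w wrs].
  have -> : q.[w] = lead_coef q * \prod_(p <- rs) (w - p).
    rewrite [in LHS]qE hornerZ horner_prod; congr (_ * _).
    by apply: eq_bigr => z _; rewrite !hornerE.
  by rewrite hornerZ invfM; ring.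
apply: qoff; rewrite qE rootZ ?lead_coef_eq0 // root_prod_XsubC //.
Qed.

(** With [g] the value at [x], the polynomial [p - g q] is [s (w - x)], so the integrand is
    [s / q + g / (w - x)]. The first term has its poles off the contour, the second has residue [g]
    for the outer circle only. *)
Lemma cauchy_formula (p q : {poly C}) x : (forall w, root q w -> off_contour w) ->
  modulus x < S -> (forall d, d \in ds -> d.2 < modulus (x - d.1)) ->
  converges (contour_sum (fun w => p.[w] / q.[w] / (w - x))) (p.[x] / q.[x]).
Proof.
move=> qoff xS xds.
have xoff : ~ off_contour x.
  case; first by move=> /lt_trans /(_ xS); rewrite ltxx.
  by move=> [d /xds xd /lt_trans /(_ xd)]; rewrite ltxx.
have qx : q.[x] != 0 by apply/negP => /qoff.
have q0 : q != 0 by apply: contraNneq qx => ->; rewrite horner0.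
set g := p.[x] / q.[x].
have /factor_theorem [s sE] : root (p - g%:P * q) x.
  by rewrite /root !hornerE /g divfK // subrr.
have Hx : converges (contour_sum (fun w => (w - x)^-1 ^+ 1)) 1.
  rewrite -[X in converges _ X](subr0 1); apply: convergesB.
    by apply: (@circle_sum_pole_in _ 0 S x 0); rewrite subr0.
  by apply: converges_discs_out => // d; exact: ds_ge0.
rewrite -[X in converges _ X](add0r g) -[X in converges _ (_ + X)]mulr1.
apply: converges_ext (convergesD (contour_sum_rational s qoff q0) (convergesZ g Hx)) => n.
rewrite -contour_sumZ -contour_sumD.
have xo w : modulus w = S \/ (exists2 d, d \in ds & modulus (w - d.1) = d.2) -> w - x != 0.
  move=> H; rewrite subr_eq0; apply/eqP => wx; case: H; rewrite wx.
    by move=> H; move: xS; rewrite H ltxx.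
  by move=> [d /xds + H]; rewrite H ltxx.
have qo w : modulus w = S \/ (exists2 d, d \in ds & modulus (w - d.1) = d.2) -> q.[w] != 0.
  move=> H; apply/negP => /qoff wo; case: H => [|[d dds]].
    by move=> wS; move: (off_contour_outer wo); rewrite wS eqxx.
  by move=> wd; move: (off_contour_inner wo dds); rewrite wd eqxx.
have E w : modulus w = S \/ (exists2 d, d \in ds & modulus (w - d.1) = d.2) ->
    s.[w] / q.[w] + g * (w - x)^-1 ^+ 1 = p.[w] / q.[w] / (w - x).
  move=> H; have := xo w H; have := qo w H => qw wx.
  have -> : p.[w] = s.[w] * (w - x) + g * q.[w].
    by have := congr1 (horner^~ w) sE; rewrite /= !hornerE => /eqP; rewrite subr_eq => /eqP.
  by rewrite expr1; field; rewrite qw wx.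
congr (_ - _).
  by apply: eq_circle_sum => [|w]; rewrite ?ltW // subr0 => wS; apply: E; left.
rewrite big_seq [RHS]big_seq; apply: eq_bigr => d dds.
apply: eq_circle_sum => [|w wd]; first exact: ds_ge0.
by apply: E; right; exists d.
Qed.

(** The combination of values is the integral against the whole kernel, which is bounded as a sum:
    its smallness comes from cancellation between its terms. The removed discs are labelled by [Ms]
    because the bound on a circle will depend on the holes merged in it. *)
Lemma cauchy_estimate (p q : {poly C}) (I : eqType) (xs : seq I) (a x : I -> C)
    (T : eqType) (Ms : seq T) (f : T -> C * R) (b0 : R) (b : T -> R) :
  ds = [seq f M | M <- Ms] ->
  (forall w, root q w -> off_contour w) ->
  (forall i, i \in xs -> modulus (x i) < S) ->
  (forall i d, i \in xs -> d \in ds -> d.2 < modulus (x i - d.1)) ->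
  (forall w, modulus w = S ->
     modulus (p.[w] / q.[w] * \sum_(i <- xs) a i / (w - x i)) <= b0) ->
  (forall M w, M \in Ms -> modulus (w - (f M).1) = (f M).2 ->
     modulus (p.[w] / q.[w] * \sum_(i <- xs) a i / (w - x i)) <= b M) ->
  modulus (\sum_(i <- xs) a i * (p.[x i] / q.[x i])) <= S * b0 + \sum_(M <- Ms) (f M).2 * b M.
Proof.
move=> dsE qoff xS xds gb0 gb.
have H := @converges_sum _ _ xs _ _ (fun i ixs => convergesZ (a i)
  (cauchy_formula (x := x i) p qoff (xS i ixs) (fun d => xds i d ixs))).
apply: (converges_modulus_le H) => n.
pose G w := p.[w] / q.[w] * \sum_(i <- xs) a i / (w - x i).
have -> : \sum_(i <- xs) a i * contour_sum (fun w => p.[w] / q.[w] / (w - x i)) n = contour_sum G n.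
  under eq_bigr do rewrite -contour_sumZ.
  rewrite /G; elim: xs {H gb0 gb G xS xds} => [|i s IH].
    rewrite big_nil /=.
    have E : contour_sum (fun=> 0 * 0) n = 0 by rewrite (contour_sumZ 0 (fun=> 0)) mul0r.
    rewrite -[LHS]E.
    by congr (contour_sum _ _); apply/funext => w; rewrite big_nil mul0r mulr0.
  rewrite big_cons IH -contour_sumD.
  by congr (contour_sum _ _); apply/funext => w; rewrite big_cons; ring.
apply: le_trans (modulusD _ _) _; rewrite modulusN; apply: lerD.
  by apply: circle_sum_le; [exact: ltW|move=> w; rewrite subr0; exact: gb0].
apply: le_trans (modulus_sum _ _ _) _; rewrite dsE big_map big_seq [leRHS]big_seq.
apply: ler_sum => M MMs; apply: circle_sum_le.
  by apply: ds_ge0; rewrite dsE map_f.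
by move=> w; exact: gb.
Qed.

End CauchyEstimate.

(** * Merging overlapping discs *)

Section Merging.
Variables (R : realType) (T : eqType) (c : T -> cplx R) (r : T -> R).
Hypothesis r_ge0 : forall t, 0 <= r t.
Local Notation cluster := (cplx R * R * seq T)%type.
Implicit Types (M : cluster) (Ms : seq cluster).

(** The radius is exactly the sum of the radii, so that sums of radius times bound over the clusters
    split into sums over the holes. A cluster is non-empty so that it has a hole of least index. *)
Definition is_cluster M := [/\ M.2 != [::], M.1.2 = \sum_(t <- M.2) r t &
  forall t, t \in M.2 -> modulus (c t - M.1.1) + r t <= M.1.2].

Definition disjoint_clusters M M' := disjoint_discs M.1 M'.1.

Definition merge_clusters M M' : cluster :=
  ((M.1.2%:C * M.1.1 + M'.1.2%:C * M'.1.1) / (M.1.2 + M'.1.2)%:C, M.1.2 + M'.1.2, M.2 ++ M'.2).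

Lemma cluster_radius_ge0 M : is_cluster M -> 0 <= M.1.2.
Proof. by move=> [_ -> _]; apply: sumr_ge0. Qed.

(* The centre of mass is at distance at most [r'] (resp. [r]) from the centre of the disc of
   radius [r] (resp. [r']). *)
Lemma is_cluster_merge M M' : is_cluster M -> is_cluster M' -> ~~ disjoint_clusters M M' ->
  is_cluster (merge_clusters M M').
Proof.
move=> cM cM'; have r0 := cluster_radius_ge0 cM; have r0' := cluster_radius_ge0 cM'.
case: cM cM' => M0 Mr Mt [M0' Mr' Mt']; rewrite /disjoint_clusters /disjoint_discs -ltNge => MM'.
have s0 : 0 < M.1.2 + M'.1.2 by apply: le_lt_trans MM'; exact: modulus_ge0.
have sm : modulus (M.1.2%:C + M'.1.2%:C) = M.1.2 + M'.1.2.
  by rewrite -[X in modulus X](rmorphD (@real_complex R)) modulus_real gtr0_norm.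
have sC : M.1.2%:C + M'.1.2%:C != 0 :> cplx R by rewrite -modulus_gt0 sm.
split=> /=; first by case: M.2 M0.
  by rewrite big_cat Mr Mr'.
move=> t; rewrite mem_cat [X in _ / X](rmorphD (@real_complex R)) => /orP[/Mt|/Mt'] H.
- have E : M.1.1 - (M.1.2%:C * M.1.1 + M'.1.2%:C * M'.1.1) / (M.1.2%:C + M'.1.2%:C) =
    M'.1.2%:C * (M.1.1 - M'.1.1) / (M.1.2%:C + M'.1.2%:C) by field.
  have : modulus (M.1.1 - (M.1.2%:C * M.1.1 + M'.1.2%:C * M'.1.1) / (M.1.2%:C + M'.1.2%:C)) <= M'.1.2.
    rewrite E modulusM modulusV sm ler_pdivrMr //.
    by rewrite modulusM modulus_real ger0_norm // ler_wpM2l // ltW.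
  by move=> H1; have := modulusBD (c t) ((M.1.2%:C * M.1.1 + M'.1.2%:C * M'.1.1) / (M.1.2%:C + M'.1.2%:C)) M.1.1; lra.
- have E : M'.1.1 - (M.1.2%:C * M.1.1 + M'.1.2%:C * M'.1.1) / (M.1.2%:C + M'.1.2%:C) =
    M.1.2%:C * (M'.1.1 - M.1.1) / (M.1.2%:C + M'.1.2%:C) by field.
  have : modulus (M'.1.1 - (M.1.2%:C * M.1.1 + M'.1.2%:C * M'.1.1) / (M.1.2%:C + M'.1.2%:C)) <= M.1.2.
    rewrite E modulusM modulusV sm ler_pdivrMr //.
    by rewrite modulusM modulus_real ger0_norm // ler_wpM2l // modulusB ltW.
  by move=> H1; have := modulusBD (c t) ((M.1.2%:C * M.1.1 + M'.1.2%:C * M'.1.1) / (M.1.2%:C + M'.1.2%:C)) M'.1.1; lra.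
Qed.

(** A merged disc may meet clusters that neither of its parts met, so it is inserted again, in a
    list that has lost one element. *)
Lemma insert_cluster Ms M : pairwise disjoint_clusters Ms ->
  (forall M', M' \in Ms -> is_cluster M') -> is_cluster M ->
  exists Ms', [/\ pairwise disjoint_clusters Ms', forall M', M' \in Ms' -> is_cluster M' &
    perm_eq (flatten (map snd Ms')) (M.2 ++ flatten (map snd Ms))].
Proof.
have [n] := ubnP (size Ms); elim: n Ms M => // n IH Ms M szMs pMs cMs cM.
have [Mall|] := boolP (all (disjoint_clusters M) Ms).
  exists (M :: Ms); split=> //=; first by rewrite Mall.
  by move=> M'; rewrite in_cons => /orP[/eqP ->|/cMs].
move=> /allPn [M' M'Ms MM'].
have [||M'' /mem_rem /cMs //||Ms' [pMs' cMs' eMs']] := IH (rem M' Ms) (merge_clusters M M').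
- by rewrite size_rem //; case: (Ms) szMs M'Ms.
- exact: subseq_pairwise (rem_subseq _ _) pMs.
- by apply: is_cluster_merge => //; exact: cMs.
exists Ms'; split=> //; apply: perm_trans eMs' _; rewrite /= -catA perm_cat2l.
by rewrite perm_sym; have := perm_flatten (perm_map snd (perm_to_rem M'Ms)).
Qed.

Lemma exists_disjoint_clusters (L : seq T) :
  exists Ms, [/\ pairwise disjoint_clusters Ms, forall M, M \in Ms -> is_cluster M &
    perm_eq (flatten (map snd Ms)) L].
Proof.
elim: L => [|t L [Ms [pMs cMs eMs]]]; first by exists [::].
have [|Ms' [pMs' cMs' eMs']] := insert_cluster (M := (c t, r t, [:: t])) pMs cMs.
  split=> //=; first by rewrite big_seq1.
  by move=> t'; rewrite inE => /eqP ->; rewrite subrr modulus0 add0r.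
exists Ms'; split=> //; apply: perm_trans eMs' _.
by rewrite perm_cons.
Qed.

End Merging.

(** If [S] is inside an interval, it moves down to the lower end and that interval is discarded; the
    total descent is at most the sum of the lengths. This will give an outer radius that no cluster
    crosses. *)
Lemma exists_off_intervals (R : realType) (T : eqType) (lo hi : T -> R) (L : seq T) (S : R) :
  (forall t, lo t <= hi t) ->
  exists S', [/\ S - \sum_(t <- L) (hi t - lo t) <= S', S' <= S &
    forall t, t \in L -> S' <= lo t \/ hi t <= S'].
Proof.
move=> lohi; have sum0 (L' : seq T) : 0 <= \sum_(t <- L') (hi t - lo t).
  by apply: sumr_ge0 => t _; rewrite subr_ge0.
have [n] := ubnP (size L); elim: n L S => // n IH L S szL.
have [Sall|] := boolP (all (fun t => (S <= lo t) || (hi t <= S)) L).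
  exists S; split=> //; first by rewrite gerBl.
  by move=> t /(allP Sall) /orP.
move=> /allPn [t tL]; rewrite negb_or -!ltNge => /andP[tS St].
have [|S' [S1 S2 S3]] := IH (rem t L) (lo t).
  by rewrite size_rem //; case: (L) szL tL.
exists S'; split; [|lra|].
  by rewrite (big_rem t) //=; lra.
move=> t' t'L; have [->|tt'] := eqVneq t' t; first by left.
by apply: S3; move: t'L; rewrite (perm_mem (perm_to_rem tL)) inE (negPf tt').
Qed.

(** * Runge's theorem for the segment *)

Section Runge.
Variables (R : realType) (rho : R).
Local Notation C := (cplx R).
Hypothesis rho_gt0 : 0 < rho.
Hypothesis rho_le1 : rho <= 1.
Implicit Types (K : C -> C) (w : C) (x t : R) (L : seq (C * R)).

Definition far_from_segment (e : R) w := forall t, 0 <= t <= 1 -> e <= modulus (w - t%:C).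

Definition cauchy_kernel L w := \sum_(i <- L) i.1 / (w - i.2%:C).

Definition runge_approximable K := forall tau : R, 0 < tau ->
  exists2 L, (forall i, i \in L -> 0 <= i.2 <= 2^-1) &
    forall w, far_from_segment rho w -> modulus (K w - cauchy_kernel L w) <= tau.

Lemma runge_approximableD K K' : runge_approximable K -> runge_approximable K' ->
  runge_approximable (fun w => K w + K' w).
Proof.
move=> aK aK' tau tau0; have t20 : 0 < tau / 2 by rewrite divr_gt0.
have [L Lh HL] := aK _ t20; have [L' Lh' HL'] := aK' _ t20.
exists (L ++ L') => [i|w ww]; first by rewrite mem_cat => /orP[/Lh|/Lh'].
rewrite /cauchy_kernel big_cat /=; have H1 := HL w ww; have H2 := HL' w ww.
have := modulusD (K w - cauchy_kernel L w) (K' w - cauchy_kernel L' w).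
by rewrite addrACA -opprD /cauchy_kernel; move: H1 H2; rewrite /cauchy_kernel; lra.
Qed.

Lemma runge_approximableZ (a : C) K : runge_approximable K -> runge_approximable (fun w => a * K w).
Proof.
move=> aK tau tau0; have a1 : 0 < modulus a + 1 by rewrite ltr_wpDl // modulus_ge0.
have [|L Lh HL] := aK (tau / (modulus a + 1)); first by rewrite divr_gt0.
exists [seq (a * i.1, i.2) | i <- L] => [i /mapP[j /Lh jL ->] //|w ww].
have -> : cauchy_kernel [seq (a * i.1, i.2) | i <- L] w = a * cauchy_kernel L w.
  by rewrite /cauchy_kernel big_map mulr_sumr; apply: eq_bigr => i _; rewrite mulrA.
have := HL w ww; rewrite ler_pdivlMr // -mulrBr modulusM; apply: le_trans.
by rewrite mulrC ler_wpM2l ?modulus_ge0 // lerDl.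
Qed.

Lemma runge_approximable_sum (I : Type) (s : seq I) (a : I -> C) (K : I -> C -> C) :
  (forall i, runge_approximable (K i)) ->
  runge_approximable (fun w => \sum_(i <- s) a i * K i w).
Proof.
move=> aK; elim: s => [|i s IH].
  move=> tau tau0; exists [::] => // w _.
  by rewrite /cauchy_kernel !big_nil subrr modulus0 ltW.
have := runge_approximableD (runge_approximableZ (a i) (aK i)) IH.
move=> H tau tau0; have [L Lh HL] := H tau tau0; exists L => // w ww.
by rewrite big_cons; exact: HL.
Qed.

Lemma far_from_segment_neq w x : far_from_segment rho w -> 0 <= x <= 1 -> w - x%:C != 0.
Proof.
by move=> ww x01; rewrite -modulus_gt0; apply: lt_le_trans rho_gt0 (ww x x01).
Qed.

(* Partial fractions of the remainder of the Lagrange interpolation of [1 / (w - x)] in [x]. *)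
Lemma interpolation_remainder (y : nat -> R) x n : injective y ->
  (forall i, 0 <= y i <= 1) -> 0 <= x <= 1 ->
  exists a : nat -> C, forall w, far_from_segment rho w ->
    (w - x%:C)^-1 - \sum_(i < n) a i * (w - (y i)%:C)^-1 =
    (w - x%:C)^-1 * \prod_(i < n) ((x - y i)%:C / (w - (y i)%:C)).
Proof.
move=> inj_y y01 x01; elim: n => [|n [a Ha]].
  by exists (fun=> 0) => w _; rewrite !big_ord0 subr0 mulr1.
pose b i := a i * (x - y n)%:C / (y i - y n)%:C.
exists (fun i => if (i < n)%N then b i else 1 - \sum_(j < n) b j) => w ww.
have w0 u : 0 <= u <= 1 -> w - u%:C != 0 by exact: far_from_segment_neq.
rewrite !big_ord_recr /= [in RHS]mulrA [in RHS]mulrA [in RHS]mulrA -Ha // ltnn.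
rewrite (eq_bigr (fun i : 'I_n => b i * (w - (y i)%:C)^-1)); last by move=> i _; rewrite ltn_ord.
have E (i : 'I_n) : b i * (w - (y i)%:C)^-1 =
    a i * (w - (y i)%:C)^-1 * ((x - y n)%:C / (w - (y n)%:C)) + b i * (w - (y n)%:C)^-1.
  have yin : (y i - y n)%:C != 0 :> C.
    rewrite -modulus_gt0 modulus_real normr_gt0 subr_eq0; apply/eqP => /inj_y E.
    by have := ltn_ord i; rewrite E ltnn.
  rewrite /b; move: yin; rewrite !rmorphB /= => yin.
  by field; rewrite yin !w0.
rewrite (eq_bigr _ (fun i _ => E i)) big_split /= -!mulr_suml.
move: (\sum_(i < n) a i * _) (\sum_(i < n) b i) => A B.
by rewrite !rmorphB /=; field; rewrite !w0.
Qed.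

(** A Taylor expansion at [b] would create poles of high order. Interpolation at distinct nodes
    keeps the poles simple, and its remainder still decreases geometrically. *)
Lemma runge_step b : 2^-1 <= b <= 1 ->
  (forall x, 0 <= x <= b -> runge_approximable (fun w => (w - x%:C)^-1)) ->
  forall x, 0 <= x <= 1 -> x <= b + rho / 4 -> runge_approximable (fun w => (w - x%:C)^-1).
Proof.
move=> b01 Hb x x01 xb.
have [xb'|bx] := leP x b; first by apply: Hb; rewrite xb'; case/andP: x01 => ->.
(* Distinct nodes in [[b - rho / 4, b]]: they are within [rho / 2] of [x] and at least [rho] away
   from [w], so each factor of the remainder is at most 1/2. *)
pose y i := b - rho / 4 / i.+1%:R.
have y4 i : 0 < rho / 4 / i.+1%:R <= rho / 4.
  rewrite !divr_gt0 //= ler_pdivrMr // ler_peMr ?ler1n // ltW // divr_gt0 //.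
have yb i : b - rho / 4 <= y i <= b by have := y4 i; rewrite /y; move: (rho / 4 / _) => q; lra.
have inj_y : injective y.
  move=> i j /eqP; rewrite /y (inj_eq (addrI _)) eqr_opp => /eqP /mulfI.
  have r4 : rho / 4 != 0 by rewrite gt_eqF // divr_gt0.
  by move=> /(_ r4) /invr_inj /eqP; rewrite eqr_nat eqSS => /eqP.
have y01 i : 0 <= y i <= 1.
  by move: (yb i) b01 rho_le1 rho_gt0; move: (y i) => u; lra.
move=> tau tau0; have t20 : 0 < tau / 2 by rewrite divr_gt0.
have [n Hn] : exists n, rho^-1 * 2^-1 ^+ n <= tau / 2.
  have : rho^-1 * 2^-1 ^+ n @[n --> \oo] --> 0.
    by rewrite -[X in _ --> X](mulr0 rho^-1); apply: cvgMr;
      apply: cvg_expr; rewrite ger0_norm ?invr_lt1 ?ltr1n // unitfE.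
  move=> /cvgrPdist_le /(_ _ t20) [n _ Hn]; exists n.
  by have := Hn n (leqnn n); rewrite sub0r normrN; apply: le_trans; exact: ler_norm.
have [a Ha] := interpolation_remainder n inj_y y01 x01.
have [|L Lh HL] := @runge_approximable_sum _ (index_enum 'I_n) (fun i => a i) (fun i w => (w - (y i)%:C)^-1) _ _ t20.
  by move=> i; apply: Hb; have := yb i; have := y01 i; lra.
exists L => // w ww.
have := modulusBD (w - x%:C)^-1 (cauchy_kernel L w) (\sum_(i < n) a i * (w - (y i)%:C)^-1).
have := HL w ww; rewrite Ha // => H1 H2; apply: le_trans H2 _.
suff : modulus ((w - x%:C)^-1 * \prod_(i < n) ((x - y i)%:C / (w - (y i)%:C))) <= tau / 2 by lra.
apply: le_trans Hn; rewrite modulusM modulusV; apply: ler_pM; rewrite ?invr_ge0 ?modulus_ge0 //.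
  rewrite lef_pV2 ?posrE //; first exact: ww.
  by apply: lt_le_trans rho_gt0 (ww x x01).
rewrite modulus_prod -[n in X in _ <= X]card_ord -prodr_const; apply: ler_prod => i _.
rewrite modulus_ge0 modulusM modulusV modulus_real ler_pdivrMr; last first.
  by apply: lt_le_trans rho_gt0 (ww _ (y01 i)).
have -> : `|x - y i| = x - y i by rewrite ger0_norm //; have := yb i; lra.
by have := ww _ (y01 i); have := yb i; lra.
Qed.

Lemma runge x : 0 <= x <= 1 -> runge_approximable (fun w => (w - x%:C)^-1).
Proof.
have H k : forall x, 0 <= x <= 1 -> x <= 2^-1 + k%:R * (rho / 4) ->
    runge_approximable (fun w => (w - x%:C)^-1).
  elim: k => [|k IH] y y01 yk.
    move=> tau tau0; exists [:: (1, y)] => [i|w _].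
      by rewrite inE => /eqP -> /=; lra.
    by rewrite /cauchy_kernel big_seq1 /= mul1r subrr modulus0 ltW.
  have k0 : 0 <= k%:R * (rho / 4) by rewrite mulr_ge0 // ltW // divr_gt0.
  apply: (@runge_step (Num.min 1 (2^-1 + k%:R * (rho / 4)))) => //.
  - by rewrite le_min ge_min; apply/andP; split; [lra|rewrite lexx].
  - move=> z; rewrite le_min => /and3P[z0 z1 zk]; apply: IH => //.
    by rewrite z0.
  - move: yk; rewrite -[k.+1%:R]natr1 mulrDl mul1r => yk.
    by move: y01 yk rho_gt0; rewrite minEle; case: ifP => _; lra.
(* That many steps of length [rho / 4] cover more than 1. *)
move=> x01; apply: (H (Num.truncn (4 / rho)).+1 x x01).
have r40 : 0 <= 4 / rho by rewrite divr_ge0 // ltW.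
have /andP[_] := truncn_itv r40.
rewrite ltr_pdivrMr // => Hk; case/andP: x01 => _ x1; apply: (le_trans x1).
by lra.
Qed.

End Runge.

(** * McKissick's functions *)

(** The tail of the series is at most [2 K 2^-n]; each of the real and imaginary parts has as limit
    the supremum of its lower bounds [a n - 2 K 2^-n]. Adding the two errors gives the constant
    4. *)
Lemma geometric_limit (R : realType) (u : nat -> cplx R) (K : R) :
  (forall n, modulus (u n.+1 - u n) <= K * 2^-1 ^+ n) ->
  exists l, forall n, modulus (u n - l) <= 4 * K * 2^-1 ^+ n.
Proof.
move=> H.
have K0 : 0 <= K by have := H 0%N; rewrite expr0 mulr1; apply: le_trans; exact: modulus_ge0.
have p0 n : 0 <= 2^-1 ^+ n :> R by rewrite exprn_ge0.
(* The factor [1 - 2^-k] is the exact partial sum and makes the induction on [k] go through. *)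
have Hk n k : modulus (u (n + k)%N - u n) <= 2 * K * 2^-1 ^+ n * (1 - 2^-1 ^+ k).
  elim: k => [|k IH]; first by rewrite addn0 subrr modulus0 expr0 subrr mulr0.
  have := modulusBD (u (n + k.+1)%N) (u n) (u (n + k)%N).
  have := H (n + k)%N; rewrite addnS exprD exprS.
  move: IH (p0 n) (p0 k); set x := _ ^+ n; set y := _ ^+ k.
  by move=> *; nra.
have real_limit (a : nat -> R) : (forall n k, `|a (n + k)%N - a n| <= 2 * K * 2^-1 ^+ n) ->
    exists l, forall n, `|a n - l| <= 2 * K * 2^-1 ^+ n.
  move=> Ha; pose A := [set x | exists n, x = a n - 2 * K * 2^-1 ^+ n].
  have An n m : a m - 2 * K * 2^-1 ^+ m <= a n + 2 * K * 2^-1 ^+ n.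
    have [/subnKC E|/ltnW/subnKC E] := leqP n m.
      have := Ha n (m - n)%N; rewrite E ler_norml => /andP[_ H1].
      have : 0 <= 2 * K * 2^-1 ^+ m by rewrite !mulr_ge0 // p0.
      lra.
    have := Ha m (n - m)%N; rewrite E ler_norml => /andP[H1 _].
    have : 0 <= 2 * K * 2^-1 ^+ n by rewrite !mulr_ge0 // p0.
      lra.
  have supA : has_sup A.
    split; first by exists (a 0%N - 2 * K * 2^-1 ^+ 0); exists 0%N.
    by exists (a 0%N + 2 * K * 2^-1 ^+ 0) => _ [n ->]; exact: An.
  exists (sup A) => n; rewrite ler_norml.
  have : sup A <= a n + 2 * K * 2^-1 ^+ n.
    by apply: ge_sup; [case: supA|move=> _ [m ->]; exact: An].
  have : a n - 2 * K * 2^-1 ^+ n <= sup A.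
    by apply: sup_upper_bound => //; exists n.
  by lra.
have Hk' n k : modulus (u (n + k)%N - u n) <= 2 * K * 2^-1 ^+ n.
  apply: le_trans (Hk n k) _; by rewrite ler_piMr ?gerBl ?mulr_ge0 ?p0.
have [|x Hx] := real_limit (fun n => complex.Re (u n)).
  move=> n k; apply: le_trans (Hk' n k); apply: le_trans (Re_le_modulus _).
  by rewrite raddfB.
have [|y Hy] := real_limit (fun n => complex.Im (u n)).
  move=> n k; apply: le_trans (Hk' n k); apply: le_trans (Im_le_modulus _).
  by rewrite raddfB.
exists (x +i* y) => n; apply: le_trans (modulus_le _) _.
have := Hx n; have := Hy n; rewrite !raddfB /=; lra.
Qed.

Lemma bernoulli (R : realType) (x : R) k : 0 <= x -> 1 + k%:R * x <= (1 + x) ^+ k.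
Proof.
move=> x0; elim: k => [|k IH]; first by rewrite expr0 mul0r addr0.
have kx : 0 <= k%:R * x * x by rewrite !mulr_ge0.
rewrite exprS -[k.+1%:R]natr1; apply: le_trans (_ : (1 + x) * (1 + k%:R * x) <= _); first nra.
by rewrite ler_wpM2l // addr_ge0.
Qed.

Section McKissick.
Variables (R : realType) (eps : R).
Local Notation C := (cplx R).
Hypothesis eps_gt0 : 0 < eps.
Hypothesis eps_le1 : eps <= 1.
Implicit Types (z : C).

(* [(mck_denom n)^-1] is close to [1] inside the circle of radius [mck_radius n] and close
   to [0] outside the circle of radius [mck_radius n.+2]. *)
Definition mck_radius n : R := if n is m.+1 then 1 - 2^-1 ^+ m.+1 else 4^-1.
(** The ratio of the radii of index [n.+2] and [n.+1] is at least [1 + 2^-(n+2)], whose power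
    [2^(n+2)] is at least 2 by Bernoulli. The factor [8 (n+1)] yields decay [2^(-8n)], which beats
    two factors of size [mck_bound], about [2^(3n)] each, and leaves [4^-n]. *)
Definition mck_degree n := (2 ^ n.+2 * (8 * n.+1))%N.
(** The degree is at most [2^(2n+5)], so holes of radius at most [1 / mck_bound n] around the zeros
    of [mck_denom n] have total radius at most [eps * 2^-(n+1)]. *)
Definition mck_bound n : R := 2 ^+ (3 * n + 6) / eps.
Definition mck_denom n z : C := 1 + (z / (mck_radius n.+1)%:C) ^+ mck_degree n.
Definition mck_fun n z : C := \prod_(k < n) (mck_denom k z)^-1.
Definition mck_small n : R := 2 * 2^-1 ^+ (8 * n.+1).
Definition mck_good z := forall n, (mck_bound n)^-1 <= modulus (mck_denom n z).

Lemma mck_bound_ge1 n : 1 <= mck_bound n.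
Proof.
rewrite /mck_bound ler_pdivlMr // mul1r; apply: le_trans eps_le1 _.
by rewrite exprn_ege1 // ler1n.
Qed.

Lemma half_expr_gt0 n : 0 < 2^-1 ^+ n :> R.
Proof. by rewrite exprn_gt0. Qed.

Lemma half_expr_ge0 n : 0 <= 2^-1 ^+ n :> R.
Proof. exact/ltW/half_expr_gt0. Qed.

Lemma half_expr_le n m : (n <= m)%N -> 2^-1 ^+ m <= 2^-1 ^+ n :> R.
Proof. by move=> nm; rewrite ler_wiXn2l //; lra. Qed.

Lemma mck_radius_gt0 n : 0 < mck_radius n.
Proof.
case: n => [|n] /=; first lra.
by have := half_expr_le (ltn0Sn n); rewrite expr1; lra.
Qed.

Lemma mck_radiusS n : mck_radius n * (1 + 2^-1 ^+ n.+1) <= mck_radius n.+1.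
Proof.
case: n => [|n] /=; first by rewrite expr1; lra.
have := half_expr_gt0 n; rewrite !exprS; set x := _ ^+ n => x0.
nra.
Qed.

Lemma mck_radius_lt1 n : mck_radius n < 1.
Proof. by case: n => [|n] /=; [lra|have := half_expr_gt0 n.+1; lra]. Qed.

Lemma mck_radius_le n m : (n <= m)%N -> mck_radius n <= mck_radius m.
Proof.
move=> /subnKC <-; elim: (m - n)%N => [|k IH]; rewrite ?addn0 // addnS.
apply: le_trans IH _; apply: le_trans (mck_radiusS (n + k)); rewrite ler_peMr ?ltW ?mck_radius_gt0 //.
by have := half_expr_gt0 (n + k).+1; lra.
Qed.

Lemma mck_small_gt0 n : 0 < mck_small n.
Proof. by rewrite mulr_gt0 ?half_expr_gt0. Qed.

Lemma mck_small_le n : mck_small n <= 8^-1 * 2^-1 ^+ n.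
Proof.
rewrite /mck_small; apply: le_trans (_ : 2 * 2^-1 ^+ (4 + n) <= _).
  by rewrite ler_wpM2l //; apply: half_expr_le; rewrite mulnS; apply: leq_add => //; rewrite leq_pmull.
rewrite exprD; have : (2^-1 : R) ^+ 4 = 16^-1 by field.
by move=> ->; have := half_expr_gt0 n; lra.
Qed.

Lemma mck_small_le1 n : mck_small n <= 1.
Proof.
by apply: le_trans (mck_small_le n) _; have := half_expr_le (leq0n n); rewrite expr0; lra.
Qed.

Lemma mck_degree_gt0 n : (0 < mck_degree n)%N.
Proof. by rewrite /mck_degree muln_gt0 expn_gt0. Qed.

Lemma expr_mck_degree n (x : R) : 2^-1 ^+ n.+2 <= x -> 2 ^+ (8 * n.+1) <= (1 + x) ^+ mck_degree n.
Proof.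
move=> nx; have x0 : 0 <= x by apply: le_trans nx; rewrite ltW ?half_expr_gt0.
have H : 2 <= (1 + x) ^+ (2 ^ n.+2).
  apply: le_trans (bernoulli _ x0); rewrite natrX.
  have E : 2 ^+ n.+2 * 2^-1 ^+ n.+2 = 1 :> R by rewrite -exprMn mulfV // expr1n.
  have : 2 ^+ n.+2 * 2^-1 ^+ n.+2 <= 2 ^+ n.+2 * x by rewrite ler_wpM2l // exprn_ge0.
  by rewrite E; lra.
by rewrite /mck_degree [(1 + x) ^+ _]exprM; apply: lerXn2r; rewrite ?nnegrE ?exprn_ge0 // addr_ge0.
Qed.

Lemma mck_denom_outer n z : mck_radius n.+2 <= modulus z ->
  modulus (mck_denom n z)^-1 <= mck_small n.
Proof.
move=> nz; have s0 := mck_radius_gt0 n.+1.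
pose x := modulus z / mck_radius n.+1 - 1.
have xE : 1 + x = modulus z / mck_radius n.+1 by rewrite /x; ring.
have nx : 2^-1 ^+ n.+2 <= x.
  rewrite /x lerBrDr addrC ler_pdivlMr //; apply: le_trans nz.
  by rewrite mulrC; exact: mck_radiusS.
have := expr_mck_degree nx; rewrite xE => H.
have Ew : modulus ((z / (mck_radius n.+1)%:C) ^+ mck_degree n) = (modulus z / mck_radius n.+1) ^+ mck_degree n.
  by rewrite modulusX modulusM modulusV modulus_real gtr0_norm.
have p2 : 2 <= 2 ^+ (8 * n.+1) :> R.
  by rewrite mulnS exprD -[leLHS]mulr1; apply: ler_pM; rewrite ?exprn_ege1 ?ler1n // -natrX ler_nat.
have D : 2 ^+ (8 * n.+1) / 2 <= modulus (mck_denom n z).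
  have := modulusBr ((z / (mck_radius n.+1)%:C) ^+ mck_degree n) (- 1).
  rewrite opprK [_ + 1]addrC -/(mck_denom n z) modulusN modulus1 Ew; lra.
have -> : mck_small n = (2 ^+ (8 * n.+1) / 2)^-1 by rewrite /mck_small exprVn invfM invrK mulrC.
rewrite modulusV.
have p0 : 0 < 2 ^+ (8 * n.+1) / 2 :> R by rewrite divr_gt0 // exprn_gt0.
by rewrite lef_pV2 ?posrE // (lt_le_trans p0 D).
Qed.

Lemma mck_denom_inner n z : mck_radius n >= modulus z ->
  modulus ((mck_denom n z)^-1 - 1) <= mck_small n.
Proof.
move=> nz; have s0 := mck_radius_gt0 n.+1.
have h0 := half_expr_gt0 n.+1.
have nx : 2^-1 ^+ n.+2 <= 2^-1 ^+ n.+1 :> R by exact: half_expr_le.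
have := expr_mck_degree nx => H.
have zs : modulus z / mck_radius n.+1 <= (1 + 2^-1 ^+ n.+1)^-1.
  rewrite ler_pdivrMr // mulrC ler_pdivlMr ?addr_gt0 //.
  apply: le_trans (mck_radiusS n); rewrite ler_wpM2r // ltW // addr_gt0 //.
have := lerXn2r (mck_degree n) _ _ zs.
rewrite !nnegrE invr_ge0 divr_ge0 ?modulus_ge0 ?(ltW s0) // addr_ge0 ?(ltW h0) //.
move=> /(_ isT isT); rewrite [leRHS]exprVn.
have Ew : modulus ((z / (mck_radius n.+1)%:C) ^+ mck_degree n) = (modulus z / mck_radius n.+1) ^+ mck_degree n.
  by rewrite modulusX modulusM modulusV modulus_real gtr0_norm.
rewrite -Ew; set w := _ ^+ mck_degree n => wle.
have wle' : modulus w <= 2^-1 ^+ (8 * n.+1).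
  apply: le_trans wle _; rewrite [leRHS]exprVn lef_pV2 ?posrE ?exprn_gt0 ?addr_gt0 //.
have p2 : 2^-1 ^+ (8 * n.+1) <= 2^-1 :> R.
  by rewrite -[leRHS]expr1; apply: half_expr_le; rewrite mulnS.
have D : 2^-1 <= modulus (mck_denom n z).
  have := modulusBr 1 (- w); rewrite opprK modulusN modulus1 -/(mck_denom n z); lra.
have d0 : mck_denom n z != 0 by rewrite -modulus_gt0; apply: lt_le_trans D.
have -> : (mck_denom n z)^-1 - 1 = - w / mck_denom n z.
  apply: (mulIf d0); rewrite mulrBl mulVf // divfK // /mck_denom -/w; ring.
rewrite modulusM modulusN modulusV /mck_small mulrC.
apply: ler_pM; rewrite ?invr_ge0 ?modulus_ge0 //.
by rewrite -[leRHS]invrK lef_pV2 ?posrE ?invr_gt0 // (lt_le_trans _ D).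
Qed.

Lemma mck_good_neq0 z n : mck_good z -> mck_denom n z != 0.
Proof.
move=> /(_ n); rewrite -modulus_gt0; apply: lt_le_trans.
by rewrite invr_gt0 (lt_le_trans _ (mck_bound_ge1 n)).
Qed.

Lemma mck_good_inv z n : mck_good z -> modulus (mck_denom n z)^-1 <= mck_bound n.
Proof.
move=> gz; rewrite modulusV -[leRHS]invrK lef_pV2 ?posrE ?modulus_gt0 ?mck_good_neq0 //.
by rewrite invr_gt0 (lt_le_trans _ (mck_bound_ge1 n)).
Qed.

Lemma mck_funS n z : mck_fun n.+1 z = mck_fun n z / mck_denom n z.
Proof. by rewrite /mck_fun big_ord_recr. Qed.

Lemma mck_fun_outer n z : mck_radius n.+2 <= modulus z ->
  modulus (mck_fun n.+1 z) <= mck_small n.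
Proof.
move=> nz; rewrite mck_funS modulusM -[leRHS]mul1r.
apply: ler_pM; rewrite ?modulus_ge0 //; last exact: mck_denom_outer.
rewrite modulus_prod; apply: le_trans (_ : \prod_(k < n) 1 <= _); last by rewrite big1.
apply: ler_prod => k _; rewrite modulus_ge0 /=.
apply: le_trans (mck_small_le1 k); apply: mck_denom_outer; apply: le_trans nz.
by apply: mck_radius_le; rewrite !ltnS ltnW.
Qed.

Definition mck_const : R := 2 ^+ 14 / eps / eps.

Lemma mck_const_ge : 2 ^+ 14 <= mck_const.
Proof.
rewrite /mck_const -mulrA ler_peMr ?exprn_ge0 // -invfM invf_ge1 ?mulr_gt0 //.
by rewrite mulr_ile1 // ltW.
Qed.

(** The factor of index [n] is already tiny at [z]; the next two may be near their critical circles,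
    where goodness bounds them by [mck_bound]. The product of the three bounds is
    [mck_const * 4^-n]. *)
Lemma mck_fun_transition n z : mck_good z -> mck_radius n.+2 <= modulus z ->
  modulus (mck_fun n.+2 z) <= mck_const * (2^-1 ^+ n * 2^-1 ^+ n) /\
  modulus (mck_fun n.+3 z) <= mck_const * (2^-1 ^+ n * 2^-1 ^+ n).
Proof.
move=> gz nz; have H1 := mck_fun_outer nz.
have H2 : modulus (mck_fun n.+2 z) <= mck_small n * mck_bound n.+1.
  by rewrite mck_funS modulusM; apply: ler_pM; rewrite ?modulus_ge0 ?mck_good_inv.
have H3 : modulus (mck_fun n.+3 z) <= mck_small n * mck_bound n.+1 * mck_bound n.+2.
  by rewrite mck_funS modulusM; apply: ler_pM; rewrite ?modulus_ge0 ?mck_good_inv.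
have E : mck_small n * mck_bound n.+1 * mck_bound n.+2 = mck_const * (2^-1 ^+ n * 2^-1 ^+ n).
  have e0 : eps != 0 by rewrite gt_eqF.
  rewrite /mck_small /mck_bound /mck_const.
  have X k : 2^-1 ^+ k = (2 ^+ k)^-1 :> R by rewrite exprVn.
  rewrite !X !mulnS !exprD expr0.
  have two0 : (2 : R) ^+ n != 0 by rewrite expf_neq0.
  by move: (2 ^+ n) two0 => y y0; field; rewrite e0 y0.
split; last by rewrite -E.
rewrite -E; apply: le_trans H2 _; rewrite ler_peMr ?mck_bound_ge1 //.
by rewrite mulr_ge0 ?(le_trans ler01 (mck_bound_ge1 _)) // ltW // mck_small_gt0.
Qed.

Lemma mck_denom_inner_le2 n z : mck_radius n >= modulus z -> modulus (mck_denom n z)^-1 <= 2.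
Proof.
move=> /mck_denom_inner; have := modulusBr (mck_denom n z)^-1 1; rewrite modulus1.
by have := mck_small_le1 n; lra.
Qed.

Lemma mck_const_gt0 : 0 < mck_const.
Proof. by rewrite !divr_gt0 // exprn_gt0. Qed.

(** Well inside its critical circle a factor is at most 2; elsewhere the transition bound applies.
    The growth [2^n] is harmless, as the next factor is within [4^-n] of 1 where this bound will be
    used. *)
Lemma mck_fun_le n z : mck_good z -> modulus (mck_fun n z) <= mck_const * 2 ^+ n.
Proof.
move=> gz; have K0 := mck_const_gt0.
have K1 := mck_const_ge.
have inner m : modulus z <= mck_radius m -> modulus (mck_fun m z) <= mck_const * 2 ^+ m ->
    modulus (mck_fun m.+1 z) <= mck_const * 2 ^+ m.+1.
  move=> zm IH; rewrite mck_funS modulusM exprSr mulrA.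
  by apply: ler_pM; rewrite ?modulus_ge0 ?mck_denom_inner_le2.
have b0 : 2 ^+ 6 <= mck_const.
  by apply: le_trans K1; rewrite ler_weXn2l // ler1n.
have F0 : modulus (mck_fun 0 z) <= mck_const.
  by rewrite /mck_fun big_ord0 modulus1; apply: le_trans b0; rewrite exprn_ege1 // ler1n.
have e1 : eps^-1 >= 1 by rewrite -[leLHS]invr1 lef_pV2 ?posrE.
have F1 : modulus (mck_fun 1 z) <= mck_const.
  rewrite mck_funS /mck_fun big_ord0 mul1r; apply: le_trans (mck_good_inv _ gz) _.
  rewrite /mck_bound /mck_const muln0 add0n.
  rewrite ler_pM2r ?invr_gt0 // -[leLHS]mulr1; apply: ler_pM; rewrite ?exprn_ge0 //.
  by rewrite ler_weXn2l // ler1n.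
have F2 : modulus (mck_fun 2 z) <= mck_const * 2 ^+ 2.
  rewrite mck_funS mck_funS /mck_fun big_ord0 mul1r modulusM.
  apply: le_trans (_ : mck_bound 0 * mck_bound 1 <= _).
    by apply: ler_pM; rewrite ?modulus_ge0 ?mck_good_inv.
  have e0 : eps != 0 by rewrite gt_eqF.
  have -> : mck_bound 0 * mck_bound 1 = 2 ^+ 15 / eps / eps.
    by rewrite /mck_bound muln0 muln1; field.
  have -> : mck_const * 2 ^+ 2 = 2 ^+ 16 / eps / eps by rewrite /mck_const; field.
  by rewrite !ler_pM2r ?invr_gt0 // ler_weXn2l // ler1n.
elim: n => [|n IH]; first by rewrite expr0 mulr1.
case: n IH => [|[|n]] IH.
- by apply: le_trans F1 _; rewrite expr1 ler_peMr ?ltW // ltr1n.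
- exact: F2.
have [nz|zn] := leP (mck_radius n.+2) (modulus z); last by apply: inner => //; exact: ltW.
have [_ H] := mck_fun_transition gz nz; apply: le_trans H _.
rewrite ler_wpM2l ?(ltW K0) //; apply: le_trans (_ : 1 <= _); last by rewrite exprn_ege1 // ler1n.
have h := half_expr_le (leq0n n); rewrite expr0 in h.
by rewrite -[leRHS]mulr1; apply: ler_pM; rewrite ?half_expr_ge0.
Qed.

Lemma mck_fun_diff n z : mck_good z ->
  modulus (mck_fun n.+1 z - mck_fun n z) <= 32 * mck_const * 2^-1 ^+ n.
Proof.
move=> gz; have K0 := mck_const_gt0.
have crude m : modulus (mck_fun m.+1 z - mck_fun m z) <= mck_const * 2 ^+ m * 3.
  have := modulusD (mck_fun m.+1 z) (- mck_fun m z); rewrite modulusN.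
  have := mck_fun_le m gz; have := mck_fun_le m.+1 gz; rewrite exprS.
  by set x := 2 ^+ m; lra.
case: n => [|[|n]].
- by apply: le_trans (crude 0%N) _; rewrite !expr0; lra.
- by apply: le_trans (crude 1%N) _; rewrite !expr1; lra.
have [nz|zn] := leP (mck_radius n.+2) (modulus z).
  have [H1 H2] := mck_fun_transition gz nz.
  have := modulusD (mck_fun n.+3 z) (- mck_fun n.+2 z); rewrite modulusN => H3.
  have h1 : 2^-1 ^+ n * 2^-1 ^+ n <= 2^-1 ^+ n :> R.
    by rewrite ler_piMr ?half_expr_ge0 // -(expr0 2^-1) half_expr_le.
  have : mck_const * (2^-1 ^+ n * 2^-1 ^+ n) <= mck_const * 2^-1 ^+ n by rewrite ler_wpM2l ?(ltW K0).
  rewrite !exprS; move: H1 H2 H3; set y := mck_const * (_ * _).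
  have : 0 < mck_const * 2^-1 ^+ n by rewrite mulr_gt0 ?half_expr_gt0.
  by set x := 2^-1 ^+ n; lra.
have -> : mck_fun n.+3 z - mck_fun n.+2 z = mck_fun n.+2 z * ((mck_denom n.+2 z)^-1 - 1).
  by rewrite (mck_funS n.+2) mulrBr mulr1.
rewrite modulusM.
apply: le_trans (_ : mck_const * 2 ^+ n.+2 * mck_small n.+2 <= _).
  by apply: ler_pM; rewrite ?modulus_ge0 ?mck_fun_le ?mck_denom_inner // (ltW zn).
have small : mck_small n.+2 <= 2^-1 ^+ n.+2 * 2^-1 ^+ n.+2.
  rewrite /mck_small -exprD; apply: le_trans (_ : 2 * 2^-1 ^+ (n.+2 + n.+2).+1 <= _).
    by rewrite ler_wpM2l // half_expr_le //; lia.
  by rewrite exprS mulrA divff // mul1r.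
apply: le_trans (_ : mck_const * 2 ^+ n.+2 * (2^-1 ^+ n.+2 * 2^-1 ^+ n.+2) <= _).
  by rewrite ler_wpM2l // mulr_ge0 ?exprn_ge0 // (ltW K0).
have -> : mck_const * 2 ^+ n.+2 * (2^-1 ^+ n.+2 * 2^-1 ^+ n.+2) = mck_const * 2^-1 ^+ n.+2.
  by rewrite mulrA -[X in X * _]mulrA -exprMn divff // expr1n mulr1.
by rewrite ler_wpM2r ?half_expr_ge0 // ler_peMl ?(ltW K0) // ler1n.
Qed.

(** The disc of radius [mck_radius 0] is inside all critical circles, so every factor is near 1. The
    increments are at most [2^-(n+2)], and staying within 1/2 of 1 keeps the limit away from 0. *)
Lemma mck_fun_center n z : modulus z <= 4^-1 -> modulus (mck_fun n z - 1) <= 2^-1 - 2^-1 ^+ n.+1.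
Proof.
move=> z4; elim: n => [|n IH].
  by rewrite /mck_fun big_ord0 subrr modulus0 expr1 subrr.
have zn : modulus z <= mck_radius n by apply: le_trans z4 (mck_radius_le (leq0n n)).
have H := mck_denom_inner zn; have S := mck_small_le n.
have F : modulus (mck_fun n z) <= 2.
  have := modulusBr (mck_fun n z) 1; rewrite modulus1.
  by have := half_expr_gt0 n.+1; lra.
have E : mck_fun n.+1 z - mck_fun n z = mck_fun n z * ((mck_denom n z)^-1 - 1).
  by rewrite mck_funS mulrBr mulr1.
have : modulus (mck_fun n.+1 z - mck_fun n z) <= 2 * (8^-1 * 2^-1 ^+ n).
  by rewrite E modulusM; apply: ler_pM; rewrite ?modulus_ge0 // (le_trans H).
have := modulusBD (mck_fun n.+1 z) 1 (mck_fun n z).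
by move: IH; rewrite !exprS; set x := 2^-1 ^+ n; lra.
Qed.

Lemma mck_limit z : mck_good z -> exists l,
  [/\ forall n, modulus (mck_fun n z - l) <= 128 * mck_const * 2^-1 ^+ n,
   1 <= modulus z -> l = 0 & modulus z <= 4^-1 -> l != 0].
Proof.
move=> gz; have [l Hl] := geometric_limit (fun n => mck_fun_diff n gz).
have small (K : R) (e : R) : 0 < e -> exists n, K * 2^-1 ^+ n < e.
  move=> e0; have : K * 2^-1 ^+ n @[n --> \oo] --> 0.
    by rewrite -[X in _ --> X](mulr0 K); apply: cvgMr; apply: cvg_expr; rewrite ger0_norm //; lra.
  move=> /cvgrPdist_lt /(_ _ e0) [n _ Hn]; exists n.
  by have := Hn n (leqnn n); rewrite sub0r normrN; apply: le_lt_trans; exact: ler_norm.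
exists l; split=> [n|z1|z4].
- by have := Hl n; rewrite mulrA (_ : 4 * 32 = 128) //; rewrite -!natrM.
- apply/eqP; rewrite -modulus_eq0; apply/negPn/negP => l0.
  have {}l0 : 0 < modulus l by rewrite lt_def l0 modulus_ge0.
  have [n Hn] := small (4 * (32 * mck_const) + 1) _ l0.
  have := Hl n.+1; have nz : mck_radius n.+2 <= modulus z by apply: le_trans z1; rewrite ltW ?mck_radius_lt1.
  have := mck_fun_outer nz; have := mck_small_le n.
  have := modulusBr l (mck_fun n.+1 z); rewrite modulusB exprS.
  move: Hn (half_expr_gt0 n) mck_const_gt0; set x := 2^-1 ^+ n; set K := mck_const.
  move=> *; have : 0 < K * x by rewrite mulr_gt0.
  lra.
- apply/eqP => l0; have [n Hn] := small (4 * (32 * mck_const)) 4^-1 ltac:(lra).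
  have := Hl n; rewrite l0 subr0; have := mck_fun_center n z4.
  have := modulusBr 1 (1 - mck_fun n z); rewrite subKr modulus1 [modulus (1 - _)]modulusB.
  by have := half_expr_gt0 n.+1; lra.
Qed.

End McKissick.

Section RootsOfMinusOne.
Variable R : realType.
Local Notation C := (cplx R).

Definition minus_one_root n : C := n.+1.-root (-1).

Lemma minus_one_rootX n : minus_one_root n ^+ n.+1 = -1.
Proof. exact: rootCK. Qed.

Lemma modulus_minus_one_root n : modulus (minus_one_root n) = 1.
Proof.
by apply: (@modulus_unity_root _ n.+1); rewrite // minus_one_rootX modulusN modulus1.
Qed.

(* The inverse of [1 + v ^+ n.+1] is the mean of the inverses of [1 - v / th] over the roots [th]
   of [th ^+ n.+1 = -1]. *)
Lemma minus_one_root_dist n (v : C) (d : R) : 0 < d ->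
  (forall l, (l < n.+1)%N -> d <= modulus (v - minus_one_root n / zeta R n ^+ l)) ->
  d <= modulus (1 + v ^+ n.+1).
Proof.
move=> d0 H; pose a := v / minus_one_root n.
have r0 : minus_one_root n != 0 by rewrite -modulus_gt0 modulus_minus_one_root.
have z0 l : zeta R n ^+ l != 0 by rewrite -modulus_gt0 modulus_zeta.
have aN : 1 + v ^+ n.+1 = 1 - a ^+ n.+1.
  by rewrite /a exprMn exprVn minus_one_rootX invrN1 mulrN1 opprK.
have ad (l : 'I_n.+1) : d <= modulus (1 - a * zeta R n ^+ l).
  have := H l (ltn_ord l).
  have -> : v - minus_one_root n / zeta R n ^+ l =
      - (minus_one_root n / zeta R n ^+ l) * (1 - a * zeta R n ^+ l).
    by rewrite /a; field; rewrite r0 z0.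
  rewrite modulusM modulusN modulusM modulusV modulus_zeta modulus_minus_one_root.
  by rewrite invr1 !mul1r.
have az0 (l : 'I_n.+1) : 1 - a * zeta R n ^+ l != 0.
  by rewrite -modulus_gt0; apply: lt_le_trans (ad l).
have E : \sum_(l < n.+1) (1 - a ^+ n.+1) / (1 - a * zeta R n ^+ l) = n.+1%:R.
  rewrite (eq_bigr (fun l : 'I_n.+1 => \sum_(j < n.+1) a ^+ j * (zeta R n ^+ l) ^+ j)).
    rewrite exchange_big /= big_ord_recl /= [X in _ + X]big1 ?addr0.
      under eq_bigr do rewrite !expr0 mulr1.
      by rewrite sumr_const card_ord.
    move=> j _; rewrite -mulr_sumr sum_zeta ?mulr0 //=.
  move=> l _; apply: (mulIf (az0 l)); rewrite divfK //.
  rewrite (eq_bigr (fun j : 'I_n.+1 => (a * zeta R n ^+ l) ^+ j)); last first.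
    by move=> j _; apply: esym; apply: exprMn.
  have := subrX1 (a * zeta R n ^+ l) n.+1.
  rewrite [(_ * _) ^+ n.+1]exprMn -[(zeta R n ^+ l) ^+ n.+1]exprM mulnC exprM (prim_expr_order (zetaP R n)) expr1n mulr1.
  by set S := \sum_(i < _) _; move=> E; rewrite -[LHS]opprB E; ring.
rewrite aN; have := modulus_sum (index_enum 'I_n.+1) xpredT (fun l => (1 - a ^+ n.+1) / (1 - a * zeta R n ^+ l)).
rewrite E modulus_nat => H1.
have : \sum_(l < n.+1) modulus ((1 - a ^+ n.+1) / (1 - a * zeta R n ^+ l)) <=
    \sum_(l < n.+1) modulus (1 - a ^+ n.+1) / d.
  apply: ler_sum => l _; rewrite modulusM modulusV ler_wpM2l ?modulus_ge0 //.
  by rewrite lef_pV2 ?posrE ?modulus_gt0.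
move=> /(le_trans H1); rewrite sumr_const card_ord -[_ / d *+ _]mulr_natl ler_pMr ?ltr0n //.
by rewrite ler_pdivlMr // mul1r.
Qed.

End RootsOfMinusOne.

(** * The holes of one disc and the functions they provide *)

Section Bump.
Variables (R : realType) (eps : R).
Local Notation C := (cplx R).
Hypothesis eps_gt0 : 0 < eps.
Hypothesis eps_le1 : eps <= 1.
Implicit Types (z a y : C) (rho : R) (X : set C).

(** For [l < mck_degree n] these are the zeros of [mck_denom n]; the predecessor compensates the
    shift in the orders of [minus_one_root] and [zeta]. *)
Definition hole_center n l : C :=
  (mck_radius R n.+1)%:C * (minus_one_root R (mck_degree n).-1 / zeta R (mck_degree n).-1 ^+ l).

(** Radius 0 beyond the degree removes nothing and lets [l] range over all of [nat]. *)
Definition hole_radius n l : R :=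
  if (l < mck_degree n)%N then mck_radius R n.+1 / mck_bound eps n else 0.

Lemma mck_bound_gt0 n : 0 < mck_bound eps n.
Proof. by rewrite (lt_le_trans _ (mck_bound_ge1 eps_gt0 eps_le1 n)). Qed.

Lemma hole_radius_ge0 n l : 0 <= hole_radius n l.
Proof.
rewrite /hole_radius; case: ifP => // _.
by rewrite divr_ge0 // ltW ?mck_radius_gt0 ?mck_bound_gt0.
Qed.

Lemma hole_near n l : modulus (hole_center n l) + hole_radius n l <= 2.
Proof.
have s0 := mck_radius_gt0 R n.+1; have s1 := mck_radius_lt1 R n.+1.
have c1 : modulus (hole_center n l) = mck_radius R n.+1.
  rewrite !modulusM modulusV modulus_zeta modulus_minus_one_root invr1 !mulr1.
  by rewrite modulus_real gtr0_norm.
rewrite c1 /hole_radius; case: ifP => _; last by lra.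
have : mck_radius R n.+1 / mck_bound eps n <= mck_radius R n.+1.
  by rewrite ler_pdivrMr ?mck_bound_gt0 // ler_peMr ?mck_bound_ge1 // ltW.
by lra.
Qed.

Lemma sum_hole_radius m : \sum_(n < m) \sum_(l < m) hole_radius n l <= eps.
Proof.
have truncated (x : R) k N : 0 <= x ->
    \sum_(l < k) (if (l < N)%N then x else 0) <= N%:R * x.
  move=> x0; apply: le_trans (_ : (minn k N)%:R * x <= _); last first.
    by rewrite ler_wpM2r // ler_nat geq_minr.
  elim: k => [|k IH]; first by rewrite big_ord0 min0n mul0r.
  rewrite big_ord_recr /=; case: (ltnP k N) IH => kN IH.
    by rewrite (minn_idPl kN) -natr1 mulrDl mul1r lerD2r.
  by rewrite addr0 (minn_idPr (leqW kN)).
have row n : \sum_(l < m) hole_radius n l <= eps * 2^-1 ^+ n.+1.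
  have x0 : 0 <= mck_radius R n.+1 / mck_bound eps n.
    by rewrite divr_ge0 // ltW ?mck_radius_gt0 ?mck_bound_gt0.
  apply: le_trans (truncated _ m (mck_degree n) x0) _.
  apply: le_trans (_ : (mck_degree n)%:R / mck_bound eps n <= _).
    rewrite ler_wpM2l // -[leRHS]mul1r ler_wpM2r ?invr_ge0 ?ltW ?mck_bound_gt0 //.
    exact: mck_radius_lt1.
  rewrite ler_pdivrMr ?mck_bound_gt0 // /mck_bound mulrA mulrAC [_ * _ / eps]mulrAC.
  rewrite divff ?gt_eqF // mul1r exprVn.
  rewrite -ler_pdivrMl ?invr_gt0 ?exprn_gt0 // invrK -!natrX -natrM ler_nat.
  rewrite /mck_degree (_ : 8 = 2 ^ 3)%N // mulnA -!expnD.
  apply: leq_trans (_ : 2 ^ (n.+1 + (n.+2 + 3)) * 2 ^ n <= _)%N.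
    by rewrite mulnA -expnD addnA leq_mul2l ltn_expl ?orbT.
  by rewrite -expnD leq_exp2l //; lia.
apply: le_trans (_ : \sum_(n < m) eps * 2^-1 ^+ n.+1 <= _).
  by apply: ler_sum => n _; exact: row.
rewrite -mulr_sumr ler_piMr ?(ltW eps_gt0) //.
suff -> : \sum_(n < m) 2^-1 ^+ n.+1 = 1 - 2^-1 ^+ m :> R by rewrite gerBl half_expr_ge0.
elim: m {row} => [|m IH]; first by rewrite big_ord0 expr0 subrr.
by rewrite big_ord_recr /= IH exprS; lra.
Qed.

Lemma mck_good_off_holes z :
  (forall n l, hole_radius n l <= modulus (z - hole_center n l)) -> mck_good eps z.
Proof.
move=> H n; have s0 := mck_radius_gt0 R n.+1.
rewrite /mck_denom -[X in _ ^+ X](prednK (mck_degree_gt0 n)).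
apply: minus_one_root_dist; first by rewrite invr_gt0 mck_bound_gt0.
move=> l lN; have := H n l; rewrite /hole_radius -(prednK (mck_degree_gt0 n)) lN /=.
rewrite /hole_center mulrC -ler_pdivlMr // => H1; apply: le_trans H1 _.
have sC : (mck_radius R n.+1)%:C != 0 :> C by rewrite -modulus_gt0 modulus_real normr_gt0 gt_eqF.
set u := minus_one_root _ _ / _.
have -> : z / (mck_radius R n.+1)%:C - u = (z - (mck_radius R n.+1)%:C * u) / (mck_radius R n.+1)%:C by field.
by rewrite [leRHS]modulusM modulusV modulus_real gtr0_norm.
Qed.

(** The degree is even, so the denominators are at least 1 on the real line, with no hole removed.
    This is how the segment gets its bump functions. *)
Lemma mck_good_real (x : R) : mck_good eps x%:C.
Proof.
move=> n; apply: (@le_trans _ _ 1); first by rewrite invf_le1 ?mck_bound_ge1 ?mck_bound_gt0.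
have -> : mck_denom n x%:C = (1 + (x / mck_radius R n.+1) ^+ mck_degree n)%:C.
  rewrite /mck_denom [RHS](rmorphD (@real_complex R)); congr (_ + _); rewrite -(fmorph_div (@real_complex R)); elim: (mck_degree n) => [|k IH]; rewrite ?expr0 ?exprS ?IH -?(rmorphM (@real_complex R)) ?rmorph1 //.
rewrite modulus_real /mck_degree expnS -mulnA exprM.
set p := _ ^+ (_ * _).
have p0 : 0 <= p by rewrite exprn_ge0 // sqr_ge0.
by rewrite ger0_norm ?addr_ge0 // lerDl.
Qed.

(** The limit is chosen point by point, but the rate of convergence is the same at all points of
    [X], so it is a uniform limit of rational functions; dividing by its value at [y] normalises
    it. *)
Lemma bump_function X a rho y : 0 < rho ->
  (forall z, X z -> mck_good eps ((z - a) / rho%:C)) -> X y -> modulus (y - a) <= rho / 4 ->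
  exists2 f, rational_algebra X f & f y = 1 /\ forall z, X z -> rho <= modulus (z - a) -> f z = 0.
Proof.
move=> rho0 Xgood Xy ya; pose phi z := (z - a) / rho%:C.
have rC : rho%:C != 0 :> C by rewrite -modulus_gt0 modulus_real normr_gt0 gt_eqF.
have modphi z : modulus (phi z) = modulus (z - a) / rho.
  by rewrite modulusM modulusV modulus_real gtr0_norm.
have Hl z : exists l, X z ->
  [/\ forall n, modulus (mck_fun n (phi z) - l) <= 128 * mck_const eps * 2^-1 ^+ n,
   1 <= modulus (phi z) -> l = 0 & modulus (phi z) <= 4^-1 -> l != 0].
  have [Xz|nXz] := pselect (X z); last by exists 0.
  by have [l Hl] := mck_limit eps_gt0 eps_le1 (Xgood z Xz); exists l.
pose g z := sval (cid (Hl z)).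
have gP z : X z ->
  [/\ forall n, modulus (mck_fun n (phi z) - g z) <= 128 * mck_const eps * 2^-1 ^+ n,
   1 <= modulus (phi z) -> g z = 0 & modulus (phi z) <= 4^-1 -> g z != 0].
  by rewrite /g; case: cid.
have gy : g y != 0.
  by have [_ _] := gP y Xy; apply; rewrite modphi ler_pdivrMr // mulrC.
have gy0 : 0 < modulus (g y) by rewrite modulus_gt0.
exists (fun z => g z / g y); last first.
  split=> [|z Xz rz]; first by rewrite divff.
  have [_ H _] := gP z Xz; rewrite H ?mul0r //.
  by rewrite modphi ler_pdivlMr // mul1r.
apply/rational_algebraP => e e0.
have [n Hn] : exists n, 128 * mck_const eps * 2^-1 ^+ n < e * modulus (g y).
  have : 128 * mck_const eps * 2^-1 ^+ n @[n --> \oo] --> 0.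
    rewrite -[X in _ --> X](mulr0 (128 * mck_const eps)); apply: cvgMr.
    by apply: cvg_expr; rewrite ger0_norm //; lra.
  move=> /cvgrPdist_lt /(_ _ (mulr_gt0 e0 gy0)) [n _ Hn]; exists n.
  by have := Hn n (leqnn n); rewrite sub0r normrN; apply: le_lt_trans; exact: ler_norm.
pose d k : {poly C} := 1 + (((rho%:C)^-1 / (mck_radius R k.+1)%:C) *: ('X - a%:P)) ^+ mck_degree k.
have dE k z : (d k).[z] = mck_denom k (phi z).
  by rewrite /d /mck_denom /phi !(hornerE, horner_exp); congr (_ + _ ^+ _); ring.
exists (fun z => mck_fun n (phi z) / g y).
  exists ((g y)^-1)%:P, (\prod_(k < n) d k) => z Xz; rewrite horner_prod hornerC.
  under eq_bigr do rewrite dE; split.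
    rewrite prodf_seq_neq0; apply/allP => k _ /=.
    by apply: mck_good_neq0 (Xgood z Xz).
  by rewrite /mck_fun prodfV mulrC.
move=> z Xz; rewrite -mulrBl modulusM modulusV ltr_pdivrMr // modulusB.
by have [H _ _] := gP z Xz; apply: le_lt_trans (H n) Hn.
Qed.

End Bump.

(** * The Swiss cheese *)

(** The factor 4 leaves room for the holes, which lie within [2 * rho i] of [a i]; the quarter is
    the disc on which McKissick's function is known not to vanish. *)
Lemma exists_disc_base (R : realType) : exists (a : nat -> cplx R) (rho : nat -> R),
  [/\ forall i, 0 < rho i <= 1, forall i, far_from_segment (4 * rho i) (a i) &
   forall (y : cplx R) (d : R), 0 < d -> far_from_segment d y ->
     exists2 i, modulus (y - a i) <= rho i / 4 & rho i <= d].
Proof.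
pose cand (c : rat * rat * nat) : cplx R * R := (ratr c.1.1 +i* ratr c.1.2, 2^-1 ^+ c.2).
pose valid (d : cplx R * R) := `[< far_from_segment (4 * d.2) d.1 >].
(* Integers that code no disc, or one too near the segment, get a fixed disc that satisfies the
   first two conditions. *)
pose disc i : cplx R * R := if unpickle i is Some c then
  if valid (cand c) then cand c else (100, 1) else (100, 1).
have far100 : far_from_segment (4 * 1) (100 : cplx R).
  move=> t t01; have := modulusBr (100 : cplx R) t%:C.
  by rewrite modulus_nat modulus_real ger0_norm; lra.
exists (fun i => (disc i).1), (fun i => (disc i).2); split=> [i|i|y d d0 yd].
- rewrite /disc; case: unpickle => [c|]; last by rewrite /= ltr01 lexx.
  case: ifP => _ /=; last by rewrite ltr01 lexx.
  by rewrite exprn_gt0 //= exprn_ile1 //; lra.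
- rewrite /disc; case: unpickle => [c|] //.
  by case: ifP => // /asboolP.
(* With [r = 2^-n], the rational centre is within [r / 4] of [y], hence at distance more than
   [4 * r] from the segment. *)
have [n Hn] : exists n, 5 * 2^-1 ^+ n < d.
  have : 5 * 2^-1 ^+ n @[n --> \oo] --> (0 : R).
    rewrite -[X in _ --> X](mulr0 5); apply: cvgMr.
    by apply: cvg_expr; rewrite ger0_norm //; lra.
  move=> /cvgrPdist_lt /(_ _ d0) [n _ Hn]; exists n.
  by have := Hn n (leqnn n); rewrite sub0r normrN; apply: le_lt_trans; exact: ler_norm.
have r0 := half_expr_gt0 R n; set r := 2^-1 ^+ n in Hn r0 *.
have approx (x : R) : exists q : rat, `|x - ratr q| <= r / 8.
  have [|q] := @rat_in_itvoo R (x - r / 8) (x + r / 8); first by lra.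
  by rewrite in_itv /= => H; exists q; rewrite ler_norml; lra.
have [p Hp] := approx (complex.Re y); have [q Hq] := approx (complex.Im y).
pose c : rat * rat * nat := (p, q, n).
have yc : modulus (y - (cand c).1) <= r / 4.
  apply: le_trans (modulus_le _) _; rewrite !raddfB /=; lra.
have vc : valid (cand c).
  apply/asboolP => t t01; have := yd t t01.
  have := modulusBD y t%:C (cand c).1; rewrite /= -/r.
  by move: yc; rewrite /=; lra.
exists (pickle c); rewrite /disc pickleK vc //=.
by rewrite -/r; lra.
Qed.

Lemma seq_minimum (T : eqType) (f : T -> nat) (s : seq T) : s != [::] ->
  exists2 t, t \in s & forall t', t' \in s -> (f t <= f t')%N.
Proof.
elim: s => // t s IH _; have [->|s0] := eqVneq s [::].
  by exists t; rewrite ?mem_head // => t'; rewrite inE => /eqP ->.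
have [t' t's Ht'] := IH s0; have [tt'|t't] := leqP (f t) (f t').
  exists t; rewrite ?mem_head // => u; rewrite inE => /orP[/eqP -> //|/Ht'].
  exact: leq_trans.
exists t'; rewrite ?inE ?t's ?orbT // => u; rewrite inE => /orP[/eqP ->|/Ht' //].
exact: ltnW.
Qed.

Section Construction.
Variables (R : realType) (a : nat -> cplx R) (rho : nat -> R) (L : nat -> seq (cplx R * R)).
Local Notation C := (cplx R).
Hypothesis rho_gt0 : forall i, 0 < rho i.
Hypothesis rho_le1 : forall i, rho i <= 1.
Hypothesis a_far : forall i, far_from_segment (4 * rho i) (a i).
Hypothesis disc_base : forall (y : C) (d : R), 0 < d -> far_from_segment d y ->
  exists2 i, modulus (y - a i) <= rho i / 4 & rho i <= d.

Fixpoint min_rho i := if i is j.+1 then Num.min (min_rho j) (rho i) else rho 0.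

Lemma min_rho_gt0 i : 0 < min_rho i.
Proof. by elim: i => //= i IH; rewrite lt_min IH rho_gt0. Qed.

Lemma min_rho_le i : min_rho i <= rho i.
Proof. by case: i => //= i; rewrite ge_min lexx orbT. Qed.

Lemma min_rho_homo i j : (i <= j)%N -> min_rho j <= min_rho i.
Proof.
move=> /subnKC <-; elim: (j - i)%N => [|k IH]; rewrite ?addn0 // addnS.
by apply: le_trans IH; rewrite /= ge_min lexx.
Qed.

Definition push_kernel j w : C := (w - 1)^-1 - cauchy_kernel (L j) w.
(** The sum of the moduli of all coefficients of K_j, the 1 being that of the pole at 1. *)
Definition kernel_mass j : R := 1 + \sum_(c <- L j) modulus c.1.

Hypothesis L_segment : forall j c, c \in L j -> 0 <= c.2 <= 2^-1.
Hypothesis kernel_small : forall j w, far_from_segment (min_rho j) w ->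
  modulus (push_kernel j w) <= j.+1%:R^-1.

Lemma kernel_mass_ge1 j : 1 <= kernel_mass j.
Proof. by rewrite lerDl sumr_ge0 // => c _; exact: modulus_ge0. Qed.

Lemma kernel_le j w (d : R) : 0 < d -> far_from_segment d w ->
  modulus (push_kernel j w) <= kernel_mass j / d.
Proof.
move=> d0 wd; apply: le_trans (modulusD _ _) _; rewrite modulusN modulusV mulrDl mul1r.
apply: lerD.
  have := wd 1; rewrite ler01 lexx => /(_ isT) w1.
  by rewrite lef_pV2 ?posrE // (lt_le_trans d0).
apply: le_trans (modulus_sum _ _ _) _; rewrite mulr_suml big_seq [leRHS]big_seq.
apply: ler_sum => c /L_segment c2; rewrite modulusM modulusV ler_wpM2l ?modulus_ge0 //.
have : d <= modulus (w - c.2%:C) by apply: wd; lra.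
by move=> wc; rewrite lef_pV2 ?posrE // (lt_le_trans d0).
Qed.

Definition total_mass i : R := \sum_(j < i.+1) kernel_mass j.

Lemma total_mass_ge i j : (j <= i)%N -> kernel_mass j <= total_mass i.
Proof.
move=> ji; rewrite /total_mass (bigD1 (Ordinal (ji : (j < i.+1)%N))) //= lerDl.
by apply: sumr_ge0 => k _; apply: le_trans ler01 (kernel_mass_ge1 k).
Qed.

Lemma total_mass_gt0 i : 0 < total_mass i.
Proof.
apply: lt_le_trans ltr01 _; apply: le_trans (kernel_mass_ge1 i) _.
exact: total_mass_ge.
Qed.

Lemma total_mass_homo i j : (i <= j)%N -> total_mass i <= total_mass j.
Proof.
move=> /subnKC <-; elim: (j - i)%N => [|k IH]; rewrite ?addn0 // addnS.
apply: le_trans IH _; rewrite [leRHS]big_ord_recr /= lerDl.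
exact: le_trans ler01 (kernel_mass_ge1 _).
Qed.

(** Decreasing in [i], so a cluster of least index [i] has radius at most
    [2 * hole_budget i <= rho i / 8]. [total_mass i] dominates the masses of K_0, ..., K_i at once,
    and [min_rho i] compensates their size near the holes. *)
Definition hole_budget i : R := min_rho i / (16 * total_mass i).
Definition hole_total i : R := 2^-1 ^+ i * hole_budget i.

Lemma hole_budget_gt0 i : 0 < hole_budget i.
Proof. by rewrite divr_gt0 ?min_rho_gt0 // mulr_gt0 ?total_mass_gt0. Qed.

Lemma hole_budget_le i : hole_budget i <= rho i / 16.
Proof.
have t1 : 1 <= total_mass i by apply: le_trans (kernel_mass_ge1 i) (total_mass_ge (leqnn i)).
rewrite /hole_budget ler_pdivrMr ?mulr_gt0 ?total_mass_gt0 //.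
apply: le_trans (min_rho_le i) _.
have -> : rho i / 16 * (16 * total_mass i) = rho i * total_mass i by field.
by rewrite ler_peMr // ltW.
Qed.

Lemma hole_budget_homo i j : (i <= j)%N -> hole_budget j <= hole_budget i.
Proof.
move=> ij; apply: ler_pM; rewrite ?invr_ge0 ?mulr_ge0 ?(ltW (min_rho_gt0 _)) ?(ltW (total_mass_gt0 _)) //.
  exact: min_rho_homo.
by rewrite lef_pV2 ?posrE ?mulr_gt0 ?total_mass_gt0 // ler_wpM2l // total_mass_homo.
Qed.

Lemma hole_total_gt0 i : 0 < hole_total i.
Proof. by rewrite mulr_gt0 ?half_expr_gt0 ?hole_budget_gt0. Qed.

Lemma hole_total_budget i j : (j <= i)%N -> hole_total i <= 2^-1 ^+ i * hole_budget j.
Proof. by move=> ji; rewrite ler_wpM2l ?half_expr_ge0 // hole_budget_homo. Qed.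

Lemma hole_total_le1 i : hole_total i <= 1.
Proof.
rewrite /hole_total -[leRHS]mulr1; apply: ler_pM; rewrite ?half_expr_ge0 ?(ltW (hole_budget_gt0 _)) //.
  by rewrite -(expr0 2^-1) half_expr_le.
by have := hole_budget_le i; have := rho_le1 i; lra.
Qed.

Lemma hole_total_mass i j : (j <= i)%N -> hole_total i * (kernel_mass j / min_rho i) <= 2^-1 ^+ i.
Proof.
move=> ji; rewrite /hole_total -mulrA ler_piMr ?half_expr_ge0 //.
have m0 := min_rho_gt0 i; have t0 := total_mass_gt0 i.
have -> : hole_budget i * (kernel_mass j / min_rho i) = kernel_mass j / (16 * total_mass i).
  by rewrite /hole_budget; field; rewrite !gt_eqF.
rewrite ler_pdivrMr ?mulr_gt0 // mul1r; apply: le_trans (total_mass_ge ji) _.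
by rewrite ler_peMl ?(ltW t0) // ler1n.
Qed.

Local Notation hole := (nat * nat * nat)%type.
Implicit Types t : hole.

Definition swiss_center t : C := a t.1.1 + (rho t.1.1)%:C * hole_center R t.1.2 t.2.
Definition swiss_radius t : R := rho t.1.1 * hole_radius (hole_total t.1.1) t.1.2 t.2.

Lemma swiss_radius_ge0 t : 0 <= swiss_radius t.
Proof.
by rewrite mulr_ge0 ?(ltW (rho_gt0 _)) // hole_radius_ge0 ?hole_total_gt0 ?hole_total_le1.
Qed.

Lemma swiss_near t : modulus (swiss_center t - a t.1.1) + swiss_radius t <= 2 * rho t.1.1.
Proof.
rewrite /swiss_center.
have -> : a t.1.1 + (rho t.1.1)%:C * hole_center R t.1.2 t.2 - a t.1.1 =
  (rho t.1.1)%:C * hole_center R t.1.2 t.2 by ring.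
rewrite modulusM modulus_real gtr0_norm // /swiss_radius -mulrDr [leRHS]mulrC.
by rewrite ler_wpM2l ?(ltW (rho_gt0 _)) // hole_near ?hole_total_gt0 ?hole_total_le1.
Qed.

(** Radius 3 leaves room for an outer circle of radius between 2 and 3, at distance at least 1 from
    the segment. *)
Definition swiss : set C := [set z | modulus z <= 3 /\
  forall t, swiss_radius t <= modulus (z - swiss_center t)].

Definition segment : set C := [set z | exists2 t : R, 0 <= t <= 1 & z = t%:C].

Lemma segment_swiss : segment `<=` swiss.
Proof.
move=> _ [x x01 ->]; split.
  by rewrite modulus_real ger0_norm; lra.
move=> t; have := a_far t.1.1 x01; have := swiss_near t; have := rho_gt0 t.1.1.
rewrite ![modulus (_ - a _)]modulusB.
have := modulusBD (a t.1.1) x%:C (swiss_center t); rewrite [modulus (x%:C - _)]modulusB.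
by lra.
Qed.

Lemma compact_swiss : compact swiss.
Proof.
apply: (@subclosed_compact _ _ [set z | modulus z <= 3]); last 2 first.
- exact: compact_disc.
- by move=> z [].
rewrite -[swiss]setCK; apply: open_closedC; apply/open_modulusP => z zX.
have [z3|z3] := ltP 3 (modulus z).
  have := @open_outer R 0 3 => /open_modulusP /(_ z).
  rewrite /= subr0 => /(_ z3) [e e0 He]; exists e => // w /He.
  by rewrite /= subr0 => w3 [] /le_lt_trans /(_ w3); rewrite ltxx.
have [t zt] : exists t, modulus (z - swiss_center t) < swiss_radius t.
  apply: contrapT => H; apply: zX; split=> // t.
  by rewrite leNgt; apply/negP => zt; apply: H; exists t.
have /open_modulusP /(_ z zt) [e e0 He] := @open_disc R (swiss_center t) (swiss_radius t).
by exists e => // w /He /= wt [_ /(_ t)]; rewrite leNgt wt.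
Qed.

Lemma regular_swiss_far (X : set C) : X `<=` swiss ->
  (forall z, X z -> exists2 d : R, 0 < d & far_from_segment d z) ->
  regular_on X (rational_algebra X).
Proof.
move=> XS Xfar F y cF FX [Xy nFy].
have /open_modulusP /(_ y nFy) [e e0 He] := closed_openC cF.
have [d d0 yd] := Xfar y Xy.
(* Points of [F] are at distance at least [e] from [y], hence at least [e - rho i / 4 >= rho i] from
   [a i], where the bump vanishes. *)
have m0 : 0 < Num.min d (e / 2) by rewrite lt_min d0 divr_gt0.
have ym : far_from_segment (Num.min d (e / 2)) y.
  by move=> t t01; apply: le_trans (yd t t01); rewrite ge_min lexx.
have [i yi ri] := disc_base m0 ym.
have good z : X z -> mck_good (hole_total i) ((z - a i) / (rho i)%:C).
  move=> /XS [_ zt]; apply: mck_good_off_holes; rewrite ?hole_total_gt0 ?hole_total_le1 //.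
  move=> n l; have := zt (i, n, l); rewrite /swiss_radius /swiss_center /=.
  have rC : (rho i)%:C != 0 :> C by rewrite -modulus_gt0 modulus_real normr_gt0 gt_eqF.
  have -> : (z - a i) / (rho i)%:C - hole_center R n l =
     (z - (a i + (rho i)%:C * hole_center R n l)) / (rho i)%:C by field.
  by rewrite modulusM modulusV modulus_real gtr0_norm // ler_pdivlMr // mulrC.
have [f fA [fy f0]] := bump_function (hole_total_gt0 i) (hole_total_le1 i) (rho_gt0 i) good Xy yi.
exists f => //; split=> // _ [z Fz <-]; apply: f0; first exact: FX.
have : ~ modulus (z - y) < e by move=> /He.
move=> /negP; rewrite -leNgt => ez.
have : rho i <= e / 2 by apply: le_trans ri _; rewrite ge_min lexx orbT.
have := modulusBD z y (a i); rewrite [modulus (a i - y)]modulusB; lra.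
Qed.

Definition box m : seq hole :=
  [seq (p, l) | p <- [seq (i, n) | i <- index_iota 0 m, n <- index_iota 0 m], l <- index_iota 0 m].

Lemma mem_box m t : (t \in box m) = [&& t.1.1 < m, t.1.2 < m & t.2 < m]%N.
Proof.
apply/idP/idP => [/allpairsP[[p l] /= [/allpairsP[[i n] /= [+ + ->]] + ->]] /=|].
  by rewrite !mem_index_iota /= => -> -> ->.
case: t => [[i n] l] /= /and3P[im nm lm]; apply/allpairsP; exists ((i, n), l).
split=> //=; last by rewrite mem_index_iota.
by apply/allpairsP; exists (i, n); rewrite !mem_index_iota.
Qed.

Lemma box_le m m' t : (m <= m')%N -> t \in box m -> t \in box m'.
Proof.
by move=> mm'; rewrite !mem_box => /and3P[? ? ?]; rewrite !(leq_trans _ mm').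
Qed.

(** The weight [F] depends only on the index of the disc. It will be the indicator of a tail, for
    the size of a cluster, and the bound of a kernel, for the integral. *)
Lemma sum_box m (F : nat -> R) : (forall i, 0 <= F i) ->
  \sum_(t <- box m) swiss_radius t * F t.1.1 <= \sum_(i < m) hole_total i * F i.
Proof.
move=> F0; rewrite /box big_allpairs big_allpairs big_mkord.
apply: ler_sum => i _; rewrite big_mkord.
have -> : \sum_(n < m) \sum_(l <- index_iota 0 m) swiss_radius (i : nat, n : nat, l) * F i =
   rho i * (\sum_(n < m) \sum_(l < m) hole_radius (hole_total i) n l) * F i.
  rewrite mulr_sumr mulr_suml; apply: eq_bigr => n _.
  by rewrite big_mkord mulr_sumr mulr_suml; apply: eq_bigr.
rewrite ler_wpM2r //.
have H := sum_hole_radius (hole_total_gt0 i) (hole_total_le1 i) m.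
apply: le_trans (_ : rho i * hole_total i <= _); first by rewrite ler_wpM2l // ltW.
by rewrite ler_piMl // ltW ?hole_total_gt0.
Qed.

Lemma sum_half_expr k m : \sum_(i < m) (if (k <= i)%N then 2^-1 ^+ i else 0) <= 2 * 2^-1 ^+ k :> R.
Proof.
suff : \sum_(i < m) (if (k <= i)%N then 2^-1 ^+ i else 0) <= 2 * 2^-1 ^+ k - 2 * 2^-1 ^+ maxn k m :> R.
  by have := half_expr_ge0 R (maxn k m); lra.
elim: m => [|m IH]; first by rewrite big_ord0 maxn0 subrr.
rewrite big_ord_recr /=; case: (leqP k m) IH => km IH.
  by rewrite (maxn_idPr (leqW km)) exprS; lra.
by rewrite addr0 (maxn_idPl km); lra.
Qed.

Lemma sum_tail_box m i : \sum_(t <- box m | (i <= t.1.1)%N) swiss_radius t <= 2 * hole_budget i.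
Proof.
pose F k : R := if (i <= k)%N then 1 else 0.
have F0 k : 0 <= F k by rewrite /F; case: ifP.
have -> : \sum_(t <- box m | (i <= t.1.1)%N) swiss_radius t = \sum_(t <- box m) swiss_radius t * F t.1.1.
  rewrite big_mkcond; apply: eq_bigr => t _; rewrite /F.
  by case: ifP; rewrite ?mulr1 ?mulr0.
apply: le_trans (sum_box m F0) _.
apply: le_trans (_ : \sum_(k < m) hole_budget i * (if (0 <= k)%N then 2^-1 ^+ k else 0) <= _).
  apply: ler_sum => k _; rewrite /F; case: ifP => ik; last first.
    by rewrite mulr0 mulr_ge0 ?(ltW (hole_budget_gt0 _)) ?half_expr_ge0.
  by rewrite mulr1 mulrC; exact: hole_total_budget.
rewrite -mulr_sumr mulrC ler_wpM2r ?(ltW (hole_budget_gt0 _)) //.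
by apply: le_trans (sum_half_expr 0 m) _; rewrite expr0 mulr1.
Qed.

(** * The kernels on the boundaries of the merged discs *)

Section Estimate.
Variables (m : nat) (Ms : seq (C * R * seq hole)).
Local Notation cluster := (is_cluster swiss_center swiss_radius).
Hypothesis Ms_cluster : forall M, M \in Ms -> cluster M.
Hypothesis Ms_box : perm_eq (flatten (map snd Ms)) (box m).

Lemma sum_clusters (g : hole -> R) :
  \sum_(M <- Ms) \sum_(t <- M.2) g t = \sum_(t <- box m) g t.
Proof. by rewrite -(perm_big _ Ms_box) big_flatten big_map. Qed.

Lemma cluster_cover t : t \in box m -> exists2 M, M \in Ms & t \in M.2.
Proof.
by rewrite -(perm_mem Ms_box) => /flattenP [s /mapP [M MMs ->] ts]; exists M.
Qed.

(* If [i] is the least index of the discs [a i, rho i] whose holes meet in the cluster [M], then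
   the diameter of [M] is small with respect to [rho i]. *)
Lemma cluster_far M t w : M \in Ms -> t \in M.2 ->
  (forall t', t' \in M.2 -> (t.1.1 <= t'.1.1)%N) -> modulus (w - M.1.1) <= M.1.2 ->
  far_from_segment (rho t.1.1) w.
Proof.
move=> MMs tM tmin wM x x01.
have [_ rE cl] := Ms_cluster MMs.
have rM : M.1.2 <= 2 * hole_budget t.1.1.
  apply: le_trans (sum_tail_box m t.1.1); rewrite rE [leRHS]big_mkcond /=.
  rewrite -sum_clusters (big_rem M) //= -[leLHS]addr0; apply: lerD.
    rewrite big_seq [leRHS]big_seq; apply: ler_sum => t' t'M.
    by rewrite tmin.
  by apply: sumr_ge0 => M' _; apply: sumr_ge0 => t' _; case: ifP => // _; exact: swiss_radius_ge0.
have := a_far t.1.1 x01; have := swiss_near t; have := hole_budget_le t.1.1; have := cl t tM.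
have := swiss_radius_ge0 t; have := rho_gt0 t.1.1.
have := modulusBD (a t.1.1) x%:C w; have := modulusBD (a t.1.1) w (swiss_center t).
have := modulusBD (swiss_center t) w M.1.1.
rewrite [modulus (a _ - swiss_center t)]modulusB [modulus (M.1.1 - w)]modulusB.
by lra.
Qed.

(** The hole of least index in [M] provides [k], and the bound attached to an index increases with
    it, so [k] is below the bounds of all holes of [M]. The contribution of a cluster is thus at
    most that of its holes taken separately. *)
Lemma kernel_on_cluster j M : M \in Ms -> exists2 k : R,
  forall w, modulus (w - M.1.1) = M.1.2 -> modulus (push_kernel j w) <= k &
  forall t, t \in M.2 ->
    k <= j.+1%:R^-1 + (if (j <= t.1.1)%N then kernel_mass j / min_rho t.1.1 else 0).
Proof.
move=> MMs; have [M0 _ _] := Ms_cluster MMs.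
have [t tM tmin] := seq_minimum (fun t => t.1.1) M0.
have V0 i : 0 <= kernel_mass j / min_rho i.
  by rewrite divr_ge0 ?(ltW (min_rho_gt0 _)) ?(le_trans ler01 (kernel_mass_ge1 _)).
have far w : modulus (w - M.1.1) = M.1.2 -> far_from_segment (min_rho t.1.1) w.
  move=> wM x x01; apply: le_trans (min_rho_le _) _.
  by apply: (cluster_far MMs tM tmin) => //; rewrite wM.
have [jt|tj] := leqP j t.1.1; last first.
  exists j.+1%:R^-1 => [w /far wt|t' _].
    by apply: kernel_small => x /wt; apply: le_trans; exact/min_rho_homo/ltnW.
  by rewrite lerDl; case: ifP.
exists (kernel_mass j / min_rho t.1.1) => [w /far wt|t' /tmin tt'].
  exact: kernel_le (min_rho_gt0 _) wt.
rewrite (leq_trans jt tt') -[leLHS]add0r; apply: lerD; first by rewrite invr_ge0.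
rewrite ler_wpM2l ?(le_trans ler01 (kernel_mass_ge1 _)) //.
by rewrite lef_pV2 ?posrE ?min_rho_gt0 // min_rho_homo.
Qed.

End Estimate.

Lemma segment_off_cluster m Ms M (x : R) :
  (forall M, M \in Ms -> is_cluster swiss_center swiss_radius M) ->
  perm_eq (flatten (map snd Ms)) (box m) -> M \in Ms -> 0 <= x <= 1 ->
  M.1.2 < modulus (x%:C - M.1.1).
Proof.
move=> Ms_cluster Ms_box MMs x01; rewrite ltNge; apply/negP => xM.
have [M0 _ _] := Ms_cluster M MMs.
have [t tM tmin] := seq_minimum (fun t => t.1.1) M0.
have := cluster_far Ms_cluster Ms_box MMs tM tmin xM x01.
by rewrite subrr modulus0 leNgt rho_gt0.
Qed.

Lemma kernelE j w : push_kernel j w = \sum_(c <- (1, 1) :: [seq (- c.1, c.2) | c <- L j]) c.1 / (w - c.2%:C).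
Proof.
rewrite big_cons big_map /push_kernel /cauchy_kernel mul1r -sumrN; congr (_ + _).
by apply: eq_bigr => c _; rewrite mulNr.
Qed.

(** The constant is 3 + 2 + 2: the outer circle has radius at most 3, the bound [1/(j+1)] on all
    holes costs [2/(j+1)], and the large values of K_j on holes of index at least [j] cost
    [2 * 2^-j]. *)
Lemma swiss_estimate j (p q : {poly C}) (B : R) : 0 < B ->
  (forall z, swiss z -> q.[z] != 0 /\ modulus (p.[z] / q.[z]) < B) ->
  modulus (p.[1] / q.[1] - \sum_(c <- L j) c.1 * (p.[c.2%:C] / q.[c.2%:C])) <= 7 * B / j.+1%:R.
Proof.
move=> B0 HB.
(* The circles of the merged discs may leave X through holes outside the box. Covering the whole
   disc by these open sets shows that, off the holes of one box, the function has no pole and is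
   bounded by [B], inside all other holes too. *)
pose U m : set C := [set z | q.[z] != 0 /\ modulus (p.[z] / q.[z]) < B] `|`
  [set z | exists2 t, t \in box m & modulus (z - swiss_center t) < swiss_radius t].
have [|||m Hm] := @compact_increasing_cover R [set z | modulus z <= 3] U (@compact_disc R 3).
- move=> m; apply: openU; first exact: open_horner_lt.
  apply/open_modulusP => z [t tm zt].
  have /open_modulusP /(_ z zt) [e e0 He] := @open_disc R (swiss_center t) (swiss_radius t).
  by exists e => // w /He wt; exists t.
- move=> m m' mm' z [zU|[t tm zt]]; first by left.
  by right; exists t => //; exact: box_le tm.
- move=> z z3; have [zX|zX] := pselect (swiss z); first by exists 0%N => //; left; exact: HB.
  have [t zt] : exists t, modulus (z - swiss_center t) < swiss_radius t.
    apply: contrapT => H; apply: zX; split=> // t.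
    by rewrite leNgt; apply/negP => zt; apply: H; exists t.
  exists (maxn t.1.1 (maxn t.1.2 t.2)).+1 => //; right; exists t => //.
  by rewrite mem_box !ltnS !leq_max !leqnn !orbT.
have [Ms [Ms_disj Ms_cluster Ms_box]] := exists_disjoint_clusters swiss_center swiss_radius_ge0 (box m).
have M_ge0 M : M \in Ms -> 0 <= M.1.2 by move=> /Ms_cluster; exact: cluster_radius_ge0 swiss_radius_ge0 _.
(* No cluster crosses the circle of radius [S]. The absolute values make the intervals well ordered
   for every triple, cluster or not. *)
have [S [S1 S2 S3]] := @exists_off_intervals R _ (fun M : C * R * seq hole => modulus M.1.1 - `|M.1.2|)
  (fun M => modulus M.1.1 + `|M.1.2|) Ms 3 (fun M => ltac:(have := normr_ge0 M.1.2; lra)).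
have sum_radius : \sum_(M <- Ms) M.1.2 <= 8^-1.
  have -> : \sum_(M <- Ms) M.1.2 = \sum_(M <- Ms) \sum_(t <- M.2) swiss_radius t.
    by rewrite big_seq [RHS]big_seq; apply: eq_bigr => M /Ms_cluster [].
  rewrite (sum_clusters Ms_box) (eq_bigl (fun t : hole => (0 <= t.1.1)%N)) //.
  apply: le_trans (sum_tail_box m 0) _.
  by have := hole_budget_le 0; have := rho_le1 0; lra.
have S_ge : 2 <= S.
  apply: le_trans S1; have : \sum_(M <- Ms) (modulus M.1.1 + `|M.1.2| - (modulus M.1.1 - `|M.1.2|)) =
      2 * \sum_(M <- Ms) M.1.2.
    rewrite mulr_sumr big_seq [RHS]big_seq; apply: eq_bigr => M /M_ge0 M0.
    by rewrite ger0_norm //; ring.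
  by move=> ->; lra.
(* The open discs of the other clusters lie beyond the outer circle, so poles in them are off the
   contour as well. *)
pose inner := [seq M <- Ms | modulus M.1.1 + M.1.2 <= S].
pose ds := [seq M.1 | M <- inner].
have innerP M : M \in inner -> M \in Ms /\ modulus M.1.1 + M.1.2 <= S.
  by rewrite mem_filter => /andP[].
have outer_or M : M \in Ms -> M \in inner \/ S <= modulus M.1.1 - M.1.2.
  move=> MMs; have := S3 M MMs; rewrite ger0_norm ?M_ge0 // => -[|SM]; first by right.
  by left; rewrite mem_filter SM.
have S0 : 0 < S by lra.
have ds_ge0 d : d \in ds -> 0 <= d.2 by move=> /mapP [M /innerP [MMs _] ->]; exact: M_ge0.
have ds_in d : d \in ds -> modulus d.1 + d.2 <= S by move=> /mapP [M /innerP [_ ?] ->].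
have ds_disj : pairwise (@disjoint_discs R) ds.
  by rewrite /ds pairwise_map; exact: pairwise_filter.
have in_hole w t : t \in box m -> modulus (w - swiss_center t) < swiss_radius t ->
    exists2 M, M \in Ms & modulus (w - M.1.1) < M.1.2.
  move=> /(cluster_cover Ms_box) [M MMs tM] wt; exists M => //.
  have [_ _ /(_ t tM)] := Ms_cluster M MMs.
  by have := modulusBD w M.1.1 (swiss_center t); lra.
have off_hole w M : M \in Ms -> modulus (w - M.1.1) < M.1.2 -> off_contour S ds w.
  move=> MMs wM; have [Min|Mout] := outer_or M MMs.
    by right; exists M.1 => //; exact: map_f.
  by left; have := modulusBr M.1.1 w; rewrite modulusB; lra.
have bounded w : modulus w <= S -> ~ off_contour S ds w -> modulus (p.[w] / q.[w]) <= B.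
  move=> wS woff; have [|[_ /ltW //]|[t tm /(in_hole _ _ tm) [M MMs]]] := Hm w.
    by rewrite /=; lra.
  by move=> /(off_hole _ _ MMs).
have roots_off w : root q w -> off_contour S ds w.
  move=> qw; have [wS|] := leP (modulus w) S; last by left.
  have [|[]|[t tm /(in_hole _ _ tm) [M MMs]]] := Hm w; first by rewrite /=; lra.
    by rewrite (eqP qw) eqxx.
  exact: off_hole.
have S_bound w : modulus w = S -> modulus (p.[w] / q.[w] * push_kernel j w) <= B * j.+1%:R^-1.
  move=> wS; rewrite modulusM; apply: ler_pM; rewrite ?modulus_ge0 //.
    apply: bounded; first by rewrite wS.
    by move=> /(off_contour_outer ds_in); rewrite wS eqxx.
  apply: kernel_small => x x01; have := modulusBr w x%:C.
  rewrite modulus_real ger0_norm; last by case/andP: x01.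
  have := min_rho_le j; have := rho_le1 j; rewrite wS; lra.
have /choice [k Hk] : forall M, exists k : R, M \in Ms ->
    (forall w, modulus (w - M.1.1) = M.1.2 -> modulus (push_kernel j w) <= k) /\
    (forall t, t \in M.2 ->
      k <= j.+1%:R^-1 + (if (j <= t.1.1)%N then kernel_mass j / min_rho t.1.1 else 0)).
  move=> M; have [MMs|_] := boolP (M \in Ms); last by exists 0.
  by have [k k1 k2] := kernel_on_cluster Ms_cluster Ms_box j MMs; exists k.
have M_bound M w : M \in inner -> modulus (w - M.1.1) = M.1.2 ->
    modulus (p.[w] / q.[w] * push_kernel j w) <= B * k M.
  move=> Min wM; have [MMs MS] := innerP M Min; rewrite modulusM.
  apply: ler_pM; rewrite ?modulus_ge0 //; last by have [H _] := Hk M MMs; exact: H.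
  apply: bounded; first by have := modulusBr w M.1.1; lra.
  by move=> /(off_contour_inner ds_in ds_disj) /(_ (map_f _ Min)); rewrite wM eqxx.
have c01 c : c \in (1, 1) :: [seq (- c.1, c.2) | c <- L j] -> 0 <= c.2 <= 1.
  rewrite inE => /orP[/eqP -> /=|/mapP[c' /L_segment c'2 ->] /=]; first by rewrite ler01 lexx.
  by lra.
have := @cauchy_estimate R S ds S0 ds_ge0 ds_in ds_disj p q _
  ((1, 1) :: [seq (- c.1, c.2) | c <- L j]) (fun c => c.1) (fun c => c.2%:C)
  _ inner (fun M => M.1) (B * j.+1%:R^-1) (fun M => B * k M) erefl roots_off.
have -> : \sum_(c <- (1, 1) :: [seq (- c.1, c.2) | c <- L j]) c.1 * (p.[c.2%:C] / q.[c.2%:C]) =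
    p.[1] / q.[1] - \sum_(c <- L j) c.1 * (p.[c.2%:C] / q.[c.2%:C]).
  rewrite big_cons big_map mul1r -sumrN; congr (_ + _).
  by apply: eq_bigr => c _; rewrite mulNr.
move=> H; apply: le_trans (H _ _ _ _) _ => {H}.
- by move=> c /c01 /andP[c0 c1]; rewrite modulus_real ger0_norm //; lra.
- by move=> c d /c01 c2 /mapP [M /innerP [MMs _] ->]; exact: segment_off_cluster Ms_cluster Ms_box MMs c2.
- by move=> w /S_bound; rewrite kernelE.
- by move=> M w Min /(M_bound M w Min); rewrite kernelE.
have tail : \sum_(M <- inner) M.1.2 * (B * k M) <= B * (4 / j.+1%:R).
  have V0 i : 0 <= (if (j <= i)%N then kernel_mass j / min_rho i else 0).
    case: ifP => // _.
    by rewrite divr_ge0 ?(ltW (min_rho_gt0 _)) ?(le_trans ler01 (kernel_mass_ge1 _)).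
  pose F i : R := j.+1%:R^-1 + (if (j <= i)%N then kernel_mass j / min_rho i else 0).
  have F0 i : 0 <= F i by rewrite addr_ge0 ?invr_ge0.
  apply: le_trans (_ : B * \sum_(M <- Ms) \sum_(t <- M.2) swiss_radius t * F t.1.1 <= _).
    rewrite mulr_sumr /inner big_filter big_mkcond /= big_seq [leRHS]big_seq.
    apply: ler_sum => M MMs; have [_ Mr _] := Ms_cluster M MMs.
    have F0' : 0 <= B * \sum_(t <- M.2) swiss_radius t * F t.1.1.
      by rewrite mulr_ge0 ?(ltW B0) // sumr_ge0 // => t _; rewrite mulr_ge0 ?swiss_radius_ge0.
    case: ifP => // _; rewrite mulrCA ler_wpM2l ?(ltW B0) // Mr mulr_suml.
    rewrite big_seq [leRHS]big_seq; apply: ler_sum => t tM.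
    by rewrite ler_wpM2l ?swiss_radius_ge0 //; have [_ H] := Hk M MMs; exact: H.
  rewrite (sum_clusters Ms_box (fun t => swiss_radius t * F t.1.1)) ler_wpM2l ?(ltW B0) //.
  apply: le_trans (sum_box m F0) _.
  apply: le_trans (_ : \sum_(i < m) (j.+1%:R^-1 * (if (0 <= i)%N then 2^-1 ^+ i else 0) +
      (if (j <= i)%N then 2^-1 ^+ i else 0)) <= _).
    apply: ler_sum => i _; rewrite /F mulrDr; apply: lerD.
      rewrite mulrC ler_wpM2l ?invr_ge0 // /hole_total ler_piMr ?half_expr_ge0 //.
      by have := hole_budget_le i; have := rho_le1 i; lra.
    by case: ifP => [ji|_]; [exact: hole_total_mass|rewrite mulr0].
  rewrite big_split /= -mulr_sumr.
  have H2 := sum_half_expr j m.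
  have H1 : \sum_(i < m) 2^-1 ^+ i <= 2 :> R.
    by have := sum_half_expr 0 m; rewrite /= expr0 mulr1.
  have H3 : 2^-1 ^+ j <= j.+1%:R^-1 :> R.
    rewrite exprVn lef_pV2 ?posrE ?exprn_gt0 // -natrX ler_nat.
    exact: ltn_expl.
  have : j.+1%:R^-1 * \sum_(i < m) 2^-1 ^+ i <= j.+1%:R^-1 * 2 :> R.
    by rewrite ler_wpM2l // invr_ge0.
  by move: H2 H3; move: (2^-1 ^+ j) (\sum_(i < m) _) (\sum_(i < m) _) (j.+1%:R^-1) => v D A u; lra.
have : S * (B * j.+1%:R^-1) <= 3 * (B * j.+1%:R^-1).
  by rewrite ler_wpM2r // mulr_ge0 ?invr_ge0 // ltW.
move: tail; rewrite mulrCA -[7 * B / _]mulrA; move: (B / j.+1%:R) (\sum_(M <- inner) _) => u T.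
by move: (S * u) => Su; lra.
Qed.

Lemma swiss_not_regular : ~ regular_on swiss (rational_algebra swiss).
Proof.
pose F : set C := [set z | complex.Im z = 0 /\ 0 <= complex.Re z <= 2^-1].
have Fseg z : F z -> exists2 x : R, 0 <= x <= 2^-1 & z = x%:C.
  by case: z => x y [/= -> x2]; exists x.
have FS : F `<=` swiss.
  move=> z /Fseg [x x2 ->]; apply: segment_swiss; exists x => //.
  by lra.
have cF : closed F.
  rewrite -[F]setCK; apply: open_closedC; apply/open_modulusP => z zF.
  have dRe w : `|complex.Re w - complex.Re z| <= modulus (w - z).
    by rewrite -raddfB; exact: Re_le_modulus.
  have dIm w : `|complex.Im w - complex.Im z| <= modulus (w - z).
    by rewrite -raddfB; exact: Im_le_modulus.
  have [y0|y0] := eqVneq (complex.Im z) 0; last first.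
    exists `|complex.Im z|; first by rewrite normr_gt0.
    move=> w wz [w0 _]; have := dIm w; rewrite w0 sub0r normrN; lra.
  have [x0|x0] := ltP (complex.Re z) 0.
    exists (- complex.Re z); first by rewrite oppr_gt0.
    by move=> w wz [_ w0]; have := dRe w; rewrite ler_norml; lra.
  have [x2|x2] := ltP 2^-1 (complex.Re z).
    exists (complex.Re z - 2^-1); first by rewrite subr_gt0.
    by move=> w wz [_ w0]; have := dRe w; rewrite ler_norml; lra.
  by exfalso; apply: zF; split=> //; rewrite x0.
have S1 : swiss 1 by apply: segment_swiss; exists 1; rewrite ?ler01 ?lexx.
move=> /(_ F 1 cF FS) []; first by split=> // -[_ /=]; lra.
move=> f [fc fA] [f1 fF].
have fF0 z : F z -> f z = 0 by move=> Fz; apply: fF; exists z.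
have [B B0 HB] := compact_bounded_modulus compact_swiss fc.
have /rational_algebraP {}fA : rational_algebra swiss f by split.
(* 28 is 4 times the constant 7 of [swiss_estimate]. *)
pose j := Num.truncn (28 * (B + 1)).
have jB : 7 * (B + 1) / j.+1%:R < 4^-1.
  have b0 : 0 <= 28 * (B + 1) by rewrite mulr_ge0 // addr_ge0 // ltW.
  have /andP[_] := truncn_itv b0; rewrite -/j ltr_pdivrMr ?ltr0n //; lra.
have A1 := kernel_mass_ge1 j.
have A0 : 0 < kernel_mass j by apply: lt_le_trans ltr01 A1.
(* The precision depends on [j], which is fixed first; this is possible as [B + 1] bounds [r]
   whatever [j] is. The combination over [[0, 1/2]] is then at most 1/4 and [|r 1| >= 3/4], against
   a difference below 1/4. *)
have [|r [p [q pq]] fr] := fA (4 * kernel_mass j)^-1; first by rewrite invr_gt0 mulr_gt0.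
have e4 : (4 * kernel_mass j)^-1 <= 4^-1 by rewrite lef_pV2 ?posrE ?mulr_gt0 // ler_peMr.
have B1 : 0 < B + 1 by rewrite addr_gt0.
have bounded z : swiss z -> q.[z] != 0 /\ modulus (p.[z] / q.[z]) < B + 1.
  move=> Sz; have [qz <-] := pq z Sz; split=> //.
  have := fr z Sz; have := HB z Sz; have := modulusBr (r z) (f z); rewrite modulusB; lra.
have := swiss_estimate j B1 bounded.
have [_ <-] := pq 1 S1.
have sumE : modulus (\sum_(c <- L j) c.1 * (p.[c.2%:C] / q.[c.2%:C])) <= 4^-1.
  apply: le_trans (modulus_sum _ _ _) _.
  apply: le_trans (_ : \sum_(c <- L j) modulus c.1 * (4 * kernel_mass j)^-1 <= _).
    rewrite big_seq [leRHS]big_seq; apply: ler_sum => c /L_segment c2.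
    have Fc : F c.2%:C by split.
    have Sc := FS _ Fc; have [_ <-] := pq _ Sc; rewrite modulusM ler_wpM2l ?modulus_ge0 //.
    by have := fr _ Sc; rewrite fF0 // sub0r modulusN => /ltW.
  rewrite -mulr_suml invfM mulrCA ler_piMr ?invr_ge0 //.
  by rewrite ler_pdivrMr // mul1r /kernel_mass lerDr.
have r1 : 1 - 4^-1 <= modulus (r 1).
  have := fr 1 S1; rewrite f1 => H; have := modulusBr 1 (1 - r 1).
  by rewrite subKr modulus1; lra.
move=> /le_lt_trans /(_ jB).
have := modulusBr (r 1) (\sum_(c <- L j) c.1 * (p.[c.2%:C] / q.[c.2%:C])).
by move: sumE r1; lra.
Qed.

End Construction.

(** * The segment, the distance to it, and the pieces of X *)

Lemma regular_segment (R : realType) : regular_on (@segment R) (rational_algebra (@segment R)).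
Proof.
move=> F y cF FX [[x x01 ->] nFx].
have /open_modulusP /(_ _ nFx) [e e0 He] := closed_openC cF.
have good z : segment z -> mck_good 1 ((z - x%:C) / e%:C : cplx R).
  move=> [t _ ->]; have -> : (t%:C - x%:C) / e%:C = ((t - x) / e)%:C :> cplx R.
    by rewrite (fmorph_div (@real_complex R)) (rmorphB (@real_complex R)).
  by apply: mck_good_real.
have Sx : segment (x%:C : cplx R) by exists x.
have [|f fA [fy f0]] := bump_function ltr01 (lexx 1) e0 good Sx.
  by rewrite subrr modulus0 divr_ge0 // ltW.
exists f => //; split=> // _ [z Fz <-]; apply: f0; first exact: FX.
by rewrite leNgt; apply/negP => /He.
Qed.

Lemma compact_segment (R : realType) : compact (@segment R).
Proof.
have -> : @segment R = (fun t : R^o => t%:C : cplx R) @` `[0, 1]%classic.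
  apply/seteqP; split=> z /= [t]; first by move=> t01 ->; exists t => //=; rewrite in_itv.
  by rewrite in_itv /= => t01 <-; exists t.
apply: continuous_compact; last exact: segment_compact.
apply: continuous_subspaceT => t A /nbhs_modulusP [e e0 He].
exists e => //= u ut; apply: He.
rewrite -(rmorphB (@real_complex R)) modulus_real distrC.
exact: ut.
Qed.

Lemma far_from_segmentP (R : realType) (z : cplx R) : ~ segment z ->
  exists2 d : R, 0 < d & far_from_segment d z.
Proof.
move=> zS.
have cS : closed (@segment R).
  by apply: compact_closed; [exact: norm_hausdorff|exact: compact_segment].
have /open_modulusP /(_ z zS) [d d0 Hd] := closed_openC cS.
exists d => // t t01; rewrite leNgt; apply/negP; rewrite modulusB => /Hd.
by apply; exists t.
Qed.

Lemma closed_far_from_segment (R : realType) (d : R) : closed [set z : cplx R | far_from_segment d z].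
Proof.
rewrite -[X in closed X]setCK; apply: open_closedC; apply/open_modulusP => z zfar.
have [t t01 zt] : exists2 t : R, 0 <= t <= 1 & modulus (z - t%:C) < d.
  apply: contrapT => H; apply: zfar => t t01; rewrite leNgt; apply/negP => zt.
  by apply: H; exists t.
have /open_modulusP /(_ z zt) [e e0 He] := @open_disc R t%:C d.
by exists e => // w /He /= wt /(_ t t01); rewrite leNgt wt.
Qed.

Local Close Scope complex_scope.
Local Close Scope ring_scope.

Theorem theorem5 (R : realType) :
  exists (X : set (cplx R)) (X_ : nat -> set (cplx R)),
    compact_plane_set X /\
    (forall k, compact_plane_set (X_ k)) /\
    X = \bigcup_k X_ k /\
    (forall k, regular_on (X_ k) (rational_algebra (X_ k))) /\
    ~ regular_on X (rational_algebra X).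
Proof.
have [a [rho [rho01 a_far disc_base]]] := exists_disc_base R.
have rho_gt0 i : (0 < rho i)%R by case/andP: (rho01 i).
have rho_le1 i : (rho i <= 1)%R by case/andP: (rho01 i).
have min_le1 j : (min_rho rho j <= 1)%R by apply: le_trans (min_rho_le _ _) (rho_le1 j).
have one01 : (0 <= (1 : R) <= 1)%R by rewrite ler01 lexx.
have /choice [L HL] : forall j, exists L : seq (cplx R * R),
    (forall c, c \in L -> 0 <= c.2 <= 2^-1)%R /\
    forall w, far_from_segment (min_rho rho j) w ->
      (modulus ((w - 1)^-1 - cauchy_kernel L w) <= j.+1%:R^-1)%R.
  move=> j; have j0 : (0 < (j.+1%:R^-1 : R))%R by rewrite invr_gt0 ltr0n.
  by have [L L1 L2] := runge (min_rho_gt0 rho_gt0 j) (min_le1 j) one01 j0; exists L.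
have L_segment j c : c \in L j -> (0 <= c.2 <= 2^-1)%R by have [H _] := HL j; exact: H.
have kernel_small j w : far_from_segment (min_rho rho j) w ->
    (modulus (push_kernel L j w) <= j.+1%:R^-1)%R by have [_ H] := HL j; exact: H.
pose X := swiss a rho L.
have segX : @segment R `<=` X by exact: segment_swiss.
have cX : compact X by exact: compact_swiss.
have seg0 : @segment R !=set0 by exists 0%R; exists 0%R; rewrite ?lexx ?ler01.
pose Y k := X `&` [set z | far_from_segment (k.+1%:R^-1)%R z].
(* An empty piece is replaced by the segment, since compact plane sets are non-empty. *)
pose X_ k := if k is k'.+1 then if pselect (Y k' !=set0) then Y k' else @segment R
  else @segment R.
exists X, X_; split; first by split=> //; case: seg0 => z /segX Xz; exists z.
split; [|split; [|split]].
- move=> [|k] /=; first by split=> //; exact: compact_segment.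
  case: pselect => Yk; last by split=> //; exact: compact_segment.
  split=> //; apply: (subclosed_compact _ cX); last by move=> z [].
  apply: closedI; last exact: closed_far_from_segment.
  by apply: compact_closed cX; exact: norm_hausdorff.
- apply/seteqP; split=> [z Xz|z [[|k] _ /=]]; last first.
  + by case: pselect => [_ []|_ /segX].
  + exact: segX.
  have [zS|/far_from_segmentP [d d0 zd]] := pselect (segment z); first by exists 0.
  have zY : Y (Num.truncn d^-1) z.
    split=> // t t01; apply: le_trans (zd t t01).
    have d0' : (0 <= d^-1)%R by rewrite invr_ge0 ltW.
    have /andP[_ /ltW] := truncn_itv d0'.
    by rewrite -[(d in (_ <= d)%R)]invrK lef_pV2 ?posrE ?invr_gt0 ?ltr0n.
  exists (Num.truncn d^-1).+1 => //=; case: pselect => // H.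
  by exfalso; apply: H; exists z.
- move=> [|k] /=; first exact: regular_segment.
  case: pselect => [Yk|nYk] /=; last exact: regular_segment.
  have YX : Y k `<=` X by move=> z [].
  have Yfar z : Y k z -> exists2 d : R, (0 < d)%R & far_from_segment d z.
    by move=> [_ zk]; exists (k.+1%:R^-1)%R; rewrite ?invr_gt0 ?ltr0n.
  by apply: regular_swiss_far YX Yfar.
- exact: swiss_not_regular.
Qed.
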